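(* For $d\in\mathbb N$, let $G\in L^\infty_{\mathcal F}(\Omega;C([0,T];\mathbb R^{d\times d}))$, $H_1,I_1,H_2,I_2\in L^\infty_{\mathcal F}(\Omega;C([0,T];\mathcal S^d))$ and $S_1,S_2\in L^\infty_{\mathcal F}(\Omega;\mathcal S^d)$. Assume that $$S_1\le S_2,\qquad 0\le H_2(\cdot)\le H_1(\cdot),\qquad I_1(\cdot)\le I_2(\cdot)$$ on $[0,T]$. For $i=1,2$, let $(K_i,M_i)\in L^\infty_{\mathcal F}(\Omega;C([0,T];\mathcal S^d))\times L^2_{\mathcal F}(0,T;\mathcal S^d)$ be the solution of the matrix-valued differential equation $$-dK(t)=-\{K(t)H_i(t)K(t)-G(t)^{\mathrm T}K(t)-K(t)G(t)-I_i(t)\}\,dt-M(t)\,dW(t),\qquad K(T)=S_i.$$ Then $$K_1(t)\le K_2(t),\qquad t\in[0,T].$$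
   Context: $T\in(0,\infty)$; $(\Omega,\mathcal F,(\mathcal F_t)_{t\in[0,T]},\mathbb P)$ is a filtered probability space carrying a one-dimensional standard Brownian motion $W$; $(\mathcal F_t)$ is the filtration generated by $W$ completed by the null sets and $\mathcal F=\mathcal F_T$. All equations and inequalities are understood $\mathbb P$-a.s. $\mathcal S^d$ is the set of symmetric $d\times d$ real matrices; for $A,B\in\mathcal S^d$, $A\ge B$ means $A-B$ is nonnegative definite. $L^2_{\mathcal F}(0,T;H)$ is the space of $H$-valued adapted processes with $\mathbb E\int_0^T|f|^2dt<\infty$. $L^\infty_{\mathcal F}(\Omega;C([0,T];H))$ is the space of progressively measurable continuous $H$-valued processes with $\operatorname{ess\,sup}_\omega\max_t|f(t,\omega)|<\infty$; $L^\infty_{\mathcal F}(\Omega;\mathcal S^d)$ is the space of essentially bounded $\mathcal F_T$-measurable $\mathcal S^d$-valued random variables. (Here $I_1,I_2$ are coefficient processes, not identity matrices.) *)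

(* Defs.v *)
From HB Require Import structures.
From mathcomp Require Import all_boot all_order all_algebra.
From mathcomp Require Import all_classical all_reals all_analysis.
From mathcomp Require Export ess_sup_inf.

Set Implicit Arguments.
Unset Strict Implicit.
Unset Printing Implicit Defensive.

Import Order.TTheory GRing.Theory Num.Theory.
Import numFieldNormedType.Exports.

Local Open Scope classical_set_scope.
Local Open Scope ring_scope.

(* Processes are total functions of a real time; only their values at times of
   [0, T] are ever constrained.  A filtration is a family of set systems
   indexed by time. *)

Definition natural_filtration (R : realType) (disp : measure_display)
    (Omega : measurableType disp) (W : R -> Omega -> R) (t : R) :
    set (set Omega) :=
  <<s [set A | exists2 s : R, 0 <= s <= t &
        exists2 B : set R, measurable B & A = W s @^-1` B] >>.

Definition completed_filtration (R : realType) (disp : measure_display)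
    (Omega : measurableType disp) (P : probability Omega R)
    (W : R -> Omega -> R) (t : R) : set (set Omega) :=
  <<s natural_filtration W t `|` [set N | P.-negligible N] >>.

(* The second parameter of normal_prob is the standard deviation; it has to be
   nonzero for normal_prob to be Gaussian, hence the strict s < t. *)
Definition standard_brownian_motion (R : realType) (disp : measure_display)
    (Omega : measurableType disp) (P : probability Omega R) (T : R)
    (W : R -> Omega -> R) : Prop :=
  [/\ forall t : R, 0 <= t <= T -> measurable_fun setT (W t),
      {ae P, forall w, W 0 w = 0},
      {ae P, forall w, {within `[0, T], continuous (fun t => W t w)}},
      forall (s t : R) (B : set R), 0 <= s -> s < t -> t <= T -> measurable B ->
        P ((fun w => W t w - W s w) @^-1` B) =
          normal_prob 0 (Num.sqrt (t - s)) B &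
      forall (s t : R) (A : set Omega) (B : set R), 0 <= s -> s < t -> t <= T ->
        natural_filtration W s A -> measurable B ->
        P (A `&` (fun w => W t w - W s w) @^-1` B) =
          (P A * P ((fun w => (W t w - W s w)%R) @^-1` B))%E].

Definition measurable_wrt (R : realType) (Omega : Type)
    (G : set (set Omega)) (X : Omega -> R) : Prop :=
  forall B : set R, measurable B -> G (X @^-1` B).

(* (t, w) |-> f t w restricted to [0, u] x Omega is measurable for
   B([0, u]) (x) F_u, written as the trace on [0, u] x Omega of the product
   sigma-algebra B(R) (x) F_u. *)
Definition progressively_measurable (R : realType) (Omega : Type) (T : R)
    (F : R -> set (set Omega)) (f : R -> Omega -> R) : Prop :=
  forall u : R, 0 <= u <= T -> forall B : set R, measurable B ->
    <<s [set E : set (R * Omega) | exists (A : set R) (C : set Omega),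
           [/\ measurable A, F u C & E = A `*` C] ] >>
      [set p | 0 <= p.1 <= u /\ B (f p.1 p.2)].

Definition symmetric_matrices (R : realType) (d : nat) : set 'M[R]_d :=
  [set A | A^T = A].

Definition nonneg_definite (R : realType) (d : nat) (A : 'M[R]_d) : Prop :=
  forall x : 'cV[R]_d, 0 <= (x^T *m A *m x) ord0 ord0.

Definition loewner_le (R : realType) (d : nat) (A B : 'M[R]_d) : Prop :=
  nonneg_definite (B - A).

(* The norm of a matrix is the library one (maximum of the moduli of the
   entries), which is equivalent to any other. *)

(* L^oo_F(Omega; H) *)
Definition Linf_rv (R : realType) (disp : measure_display)
    (Omega : measurableType disp) (P : probability Omega R) (T : R)
    (F : R -> set (set Omega)) (d : nat) (H : set 'M[R]_d)
    (X : Omega -> 'M[R]_d) : Prop :=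
  [/\ forall w, H (X w),
      forall i j, measurable_wrt (F T) (fun w => X w i j) &
      (ess_sup P (fun w => (`|X w|)%:E) < +oo)%E].

(* L^oo_F(Omega; C([0, T]; H)) *)
Definition Linf_continuous (R : realType) (disp : measure_display)
    (Omega : measurableType disp) (P : probability Omega R) (T : R)
    (F : R -> set (set Omega)) (d : nat) (H : set 'M[R]_d)
    (f : R -> Omega -> 'M[R]_d) : Prop :=
  [/\ forall (t : R) w, 0 <= t <= T -> H (f t w),
      forall i j, progressively_measurable T F (fun t w => f t w i j),
      forall w, {within `[0, T], continuous (fun t => f t w)} &
      (ess_sup P
         (fun w => ereal_sup [set (`|f t w|)%:E | t in `[0%R, T]]) < +oo)%E].

(* L^2_F(0, T; H) *)
Definition L2_adapted (R : realType) (disp : measure_display)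
    (Omega : measurableType disp) (P : probability Omega R) (T : R)
    (F : R -> set (set Omega)) (d : nat) (H : set 'M[R]_d)
    (f : R -> Omega -> 'M[R]_d) : Prop :=
  [/\ forall (t : R) w, 0 <= t <= T -> H (f t w),
      forall i j, measurable_fun (`[0, T] `*` [set: Omega])
                    (fun p : R * Omega => f p.1 p.2 i j),
      forall (t : R) i j, 0 <= t <= T -> measurable_wrt (F t) (fun w => f t w i j) &
      (\int[P]_w \int[lebesgue_measure]_(t in `[0%R, T])
         (`|f t w| ^+ 2)%:E < +oo)%E].

(* The simple process \sum_(k < n) xi_k 1_{]tau_k, tau_(k+1)]}. *)
Record simple_process (R : realType) (Omega : Type) := SimpleProcess {
  sp_size : nat;
  sp_time : nat -> R;
  sp_coef : nat -> Omega -> R }.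

Definition simple_process_on (R : realType) (Omega : Type)
    (F : R -> set (set Omega)) (a b : R) (phi : simple_process R Omega) :
    Prop :=
  [/\ a <= sp_time phi 0, sp_time phi (sp_size phi) <= b,
      forall k, (k < sp_size phi)%N -> sp_time phi k <= sp_time phi k.+1,
      forall k, (k < sp_size phi)%N ->
        measurable_wrt (F (sp_time phi k)) (sp_coef phi k) &
      forall k, (k < sp_size phi)%N ->
        exists C : R, forall w, `|sp_coef phi k w| <= C].

Definition sp_eval (R : realType) (Omega : Type) (phi : simple_process R Omega)
    (t : R) (w : Omega) : R :=
  \sum_(k < sp_size phi)
    sp_coef phi k w * \1_(`]sp_time phi k, sp_time phi k.+1]) t.

Definition sp_integral (R : realType) (Omega : Type) (W : R -> Omega -> R)
    (phi : simple_process R Omega) (w : Omega) : R :=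
  \sum_(k < sp_size phi)
    sp_coef phi k w * (W (sp_time phi k.+1) w - W (sp_time phi k) w).

(* X = \int_a^b f dW: the Ito integral as the L^2(P)-limit of the integrals of
   simple processes converging to f in L^2([a, b] x Omega).  By the Ito
   isometry, X is determined up to a P-null set. *)
Definition ito_integral (R : realType) (disp : measure_display)
    (Omega : measurableType disp) (P : probability Omega R)
    (F : R -> set (set Omega)) (W : R -> Omega -> R) (a b : R)
    (f : R -> Omega -> R) (X : Omega -> R) : Prop :=
  measurable_fun setT X /\
  exists phi : nat -> simple_process R Omega,
    [/\ forall m, simple_process_on F a b (phi m),
        (\int[P]_w \int[lebesgue_measure]_(t in `[a, b])
           ((f t w - sp_eval (phi m) t w) ^+ 2)%:E)%E @[m --> \oo] --> 0%E &
        (\int[P]_w ((X w - sp_integral W (phi m) w) ^+ 2)%:E)%E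
          @[m --> \oo] --> 0%E].

(* (K, M) solves the equation, i.e. for every t in [0, T], almost surely,
   K t = S - \int_t^T (K H K - G^T K - K G - I) ds - \int_t^T M dW,
   both integrals being taken entrywise. *)
Definition riccati_bsde (R : realType) (disp : measure_display)
    (Omega : measurableType disp) (P : probability Omega R) (T : R)
    (F : R -> set (set Omega)) (W : R -> Omega -> R) (d : nat)
    (G H I : R -> Omega -> 'M[R]_d) (S : Omega -> 'M[R]_d)
    (K M : R -> Omega -> 'M[R]_d) : Prop :=
  forall t : R, 0 <= t <= T ->
    exists2 N : Omega -> 'M[R]_d,
      forall i j,
        ito_integral P F W t T (fun s w => M s w i j) (fun w => N w i j) &
      {ae P, forall w, K t w =
        S w
        - (\matrix_(i, j) \int[lebesgue_measure]_(s in `[t, T])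
             (K s w *m H s w *m K s w - (G s w)^T *m K s w
              - K s w *m G s w - I s w) i j)
        - N w}.

(* Main.v *)
Require Import Defs.
From HB Require Import structures.
From mathcomp Require Import all_boot all_order all_algebra.
From mathcomp Require Import all_classical all_reals all_analysis.
From mathcomp Require Import measurable_realfun.
From mathcomp Require Import ring lra.
Import Order.TTheory GRing.Theory Num.Theory.
Import numFieldNormedType.Exports.
Local Open Scope classical_set_scope.
Local Open Scope ring_scope.

Set Implicit Arguments.
Unset Strict Implicit.
Unset Printing Implicit Defensive.

(** The difference D = K2 - K1 solves a linear equation.  With
      A = G - H2 (K1 + K2) / 2,   Q = K1 (H1 - H2) K1 + (I2 - I1),
    symmetry of H2, K1, K2 gives (lemma riccati_rhs_difference)
      D(s) = D(t) + int_s^t (A^T D + D A + Q) dr - int_s^t (M2 - M1) dW,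
    where A, D, Q are bounded and continuous in time and Q >= 0, D(T) >= 0.
    If Phi' = A Phi then Phi^T D Phi + int Phi^T Q Phi dr is a martingale,
    which writes D(t) as a conditional expectation of something nonnegative.

    The proof carries this out in discrete time, where the stochastic integral
    enters through the mean zero property of its increments.  Fix t0 and a
    vector v, let x_0 be v on the event v^T D(t0) v < 0 and 0 elsewhere, and
    follow the Euler scheme
    x_{k+1} = x_k + h A(t_k) x_k on the grid t_k = t0 + k h of [t0, T].  Put
      Z = x_0^T D(t0) x_0
          - sum_k x_k^T (D(t_k) - D(t_{k+1}) - int_{t_k}^{t_{k+1}} drift) x_k.
    - Almost surely the matrix in the sum is an increment of the noise, which
      has mean zero against the F_{t_k}-measurable bounded x_k x_k^T
      (ito_integral_mean0).  Hence E Z = E (x_0^T D(t0) x_0).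
    - Path by path, telescoping (euler_telescope) turns Z into x_n^T D(T) x_n
      plus an integral whose integrand is x_k^T Q x_k up to the modulus of
      continuity of A and D; so Z is bounded below uniformly in the step, and
      its negative part vanishes as h -> 0 (defect_bounds).
    By dominated convergence E (x_0^T D(t0) x_0) >= 0; but x_0^T D(t0) x_0 is
    the nonpositive min(v^T D(t0) v, 0), so it is almost surely zero
    (quadratic_form_ge0).  Taking v integral and t0 rational leaves one null
    set, and continuity together with homogeneity of the quadratic form gives
    the other vectors and times (qform_ge0_dense). *)

(** * Matrix norms and quadratic forms *)

Lemma mx_entry_le_norm (R : realType) (m n : nat) (A : 'M[R]_(m, n)) i j :
  `|A i j| <= `|A|.
Proof.
rewrite [leRHS]/Num.norm /= mx_normrE.
exact: (le_bigmax _ (fun ij : 'I_m * 'I_n => `|A ij.1 ij.2|) (i, j)).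
Qed.

Lemma mx_norm_le (R : realType) (m n : nat) (A : 'M[R]_(m, n)) (c : R) :
  0 <= c -> (forall i j, `|A i j| <= c) -> `|A| <= c.
Proof.
move=> c0 Ac; rewrite [leLHS]/Num.norm /= mx_normrE.
by apply/bigmax_leP; split => // -[i j] _ /=.
Qed.

(** The norm of a matrix is the largest modulus of its entries, so a product
    costs a factor equal to the inner dimension. *)
Lemma norm_mulmx (R : realType) (m n p : nat) (A : 'M[R]_(m, n))
    (B : 'M[R]_(n, p)) : `|A *m B| <= n%:R * `|A| * `|B|.
Proof.
apply: mx_norm_le => [|i j]; first by rewrite !mulr_ge0.
rewrite mxE (le_trans (ler_norm_sum _ _ _))//.
rewrite (@le_trans _ _ (\sum_(k < n) `|A| * `|B|))//.
  by apply: ler_sum => k _; rewrite normrM ler_pM ?mx_entry_le_norm.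
by rewrite sumr_const card_ord -[X in X <= _]mulr_natl mulrA.
Qed.

Definition qform (R : realType) (d : nat) (A : 'M[R]_d) (x : 'cV[R]_d) : R :=
  (x^T *m A *m x) ord0 ord0.

Lemma qformE (R : realType) (d : nat) (A : 'M[R]_d) (x : 'cV[R]_d) :
  qform A x = \sum_i \sum_j x i ord0 * A i j * x j ord0.
Proof.
rewrite /qform mxE exchange_big /=; apply: eq_bigr => j _.
rewrite mxE mulr_suml; apply: eq_bigr => i _.
by rewrite mxE.
Qed.

Lemma qformD (R : realType) (d : nat) (A B : 'M[R]_d) (x : 'cV[R]_d) :
  qform (A + B) x = qform A x + qform B x.
Proof. by rewrite /qform mulmxDr mulmxDl mxE. Qed.

Lemma qformN (R : realType) (d : nat) (A : 'M[R]_d) (x : 'cV[R]_d) :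
  qform (- A) x = - qform A x.
Proof. by rewrite /qform mulmxN mulNmx mxE. Qed.

Lemma qformB (R : realType) (d : nat) (A B : 'M[R]_d) (x : 'cV[R]_d) :
  qform (A - B) x = qform A x - qform B x.
Proof. by rewrite qformD qformN. Qed.

Lemma qform_tr (R : realType) (d : nat) (A : 'M[R]_d) (x : 'cV[R]_d) :
  qform A^T x = qform A x.
Proof.
have -> : qform A x = (x^T *m A *m x)^T ord0 ord0 by rewrite [RHS]mxE.
by rewrite /qform !trmx_mul trmxK mulmxA.
Qed.

Lemma qform_conj (R : realType) (d : nat) (A B : 'M[R]_d) (x : 'cV[R]_d) :
  qform (B^T *m A *m B) x = qform A (B *m x).
Proof. by rewrite /qform trmx_mul !mulmxA. Qed.

Lemma qform_scale (R : realType) (d : nat) (A : 'M[R]_d) (c : R)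
    (x : 'cV[R]_d) : qform A (c *: x) = c ^+ 2 * qform A x.
Proof.
rewrite /qform.
have -> : (c *: x)^T = c *: x^T by apply/matrixP => i j; rewrite !mxE.
by rewrite -!scalemxAl -scalemxAr scalerA mxE expr2.
Qed.

Lemma norm_qform (R : realType) (d : nat) (A : 'M[R]_d) (x : 'cV[R]_d) :
  `|qform A x| <= d%:R ^+ 2 * `|A| * `|x| ^+ 2.
Proof.
rewrite qformE (le_trans (ler_norm_sum _ _ _))//.
rewrite (@le_trans _ _ (\sum_(i < d) \sum_(j < d) `|x| * `|A| * `|x|))//.
  apply: ler_sum => i _; rewrite (le_trans (ler_norm_sum _ _ _))//.
  apply: ler_sum => j _; rewrite !normrM.
  by rewrite !ler_pM ?mulr_ge0 ?mx_entry_le_norm.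
rewrite !sumr_const card_ord -[X in X <= _]mulr_natr -[X in X * _ <= _]mulr_natr.
by rewrite le_eqVlt; apply/orP; left; apply/eqP; ring.
Qed.

(** * Integrals of finite sums and of quadratic forms *)

Lemma Rintegral_sum d (T : measurableType d) (R : realType)
    (mu : {measure set T -> \bar R}) (D : set T) (mD : measurable D) (n : nat)
    (f : 'I_n -> T -> R) :
  (forall i, mu.-integrable D (EFin \o f i)) ->
  \int[mu]_(r in D) (\sum_(i < n) f i r) =
  \sum_(i < n) \int[mu]_(r in D) f i r.
Proof.
move=> fi; rewrite /Rintegral.
under eq_integral do rewrite -sumEFin.
rewrite integral_sum//.
rewrite -sum_fine// => i _; apply: integrable_fin_num => //.
exact: fi.
Qed.

Lemma integrable_sum_fin d (T : measurableType d) (R : realType)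
    (mu : {measure set T -> \bar R}) (D : set T) (mD : measurable D) (n : nat)
    (f : 'I_n -> T -> R) :
  (forall i, mu.-integrable D (EFin \o f i)) ->
  mu.-integrable D (EFin \o (fun r => \sum_(i < n) f i r)).
Proof.
move=> fi; rewrite (_ : EFin \o _ = fun r => (\sum_(i < n) (EFin \o f i) r)%E).
  by apply: integrable_sum => // i _; exact: fi.
by apply/funext => r /=; rewrite sumEFin.
Qed.

Lemma integrable_scale d (T : measurableType d) (R : realType)
    (mu : {measure set T -> \bar R}) (D : set T) (mD : measurable D)
    (c : R) (f : T -> R) : mu.-integrable D (EFin \o f) ->
  mu.-integrable D (EFin \o (fun r => c * f r)).
Proof.
move=> fi; rewrite (_ : EFin \o _ = fun r => (c%:E * (EFin \o f) r)%E)//.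
exact: integrableZl.
Qed.

(** A quadratic form is linear in its matrix, hence commutes with entrywise
    integration. *)
Lemma qform_integral (R : realType) (d : nat) (D : set R) (mD : measurable D)
    (b : R -> 'M[R]_d) (x : 'cV[R]_d) :
  (forall i j, (@lebesgue_measure R).-integrable D (fun r => (b r i j)%:E)) ->
  (@lebesgue_measure R).-integrable D (fun r => (qform (b r) x)%:E) /\
  qform (\matrix_(i, j) \int[lebesgue_measure]_(r in D) b r i j) x =
    \int[lebesgue_measure]_(r in D) qform (b r) x.
Proof.
move=> bi.
have E r : qform (b r) x =
    \sum_i \sum_j (x i ord0 * x j ord0) * b r i j.
  by rewrite qformE; apply: eq_bigr => i _; apply: eq_bigr => j _; rewrite mulrAC.
have i1 i j : (@lebesgue_measure R).-integrable D
    (EFin \o (fun r => (x i ord0 * x j ord0) * b r i j)).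
  by apply: integrable_scale => //; exact: bi.
have i2 i : (@lebesgue_measure R).-integrable D
    (EFin \o (fun r => \sum_j (x i ord0 * x j ord0) * b r i j)).
  exact: integrable_sum_fin.
split.
  rewrite (_ : (fun r => _) =
    EFin \o (fun r => \sum_i \sum_j (x i ord0 * x j ord0) * b r i j)).
    exact: integrable_sum_fin.
  by apply/funext => r /=; rewrite E.
under [RHS]eq_Rintegral do rewrite E.
rewrite Rintegral_sum// qformE; apply: eq_bigr => i _.
rewrite Rintegral_sum//; apply: eq_bigr => j _.
by rewrite RintegralZl//; [rewrite mxE mulrAC|exact: bi].
Qed.

(** * The Euler scheme and its defect along a path *)

(** The explicit Euler scheme with step h for the linear equation x' = a x. *)
Fixpoint euler (R : realType) (d : nat) (h : R) (a : nat -> 'M[R]_d)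
    (x0 : 'cV[R]_d) (k : nat) : 'cV[R]_d :=
  if k is k'.+1 then euler h a x0 k' + h *: (a k' *m euler h a x0 k') else x0.

(** One Euler step changes the quadratic form of D by a discrete version of
    a^T D + D a, with a second order correction. *)
Lemma qform_step (R : realType) (d : nat) (h : R) (D a : 'M[R]_d)
    (x : 'cV[R]_d) :
  qform D (x + h *: (a *m x)) =
  qform D x + h * (qform (a^T *m D) x + qform (D *m a) x + h * qform D (a *m x)).
Proof.
rewrite /qform.
have -> : (x + h *: (a *m x))^T = x^T + h *: (x^T *m a^T).
  by rewrite -trmx_mul; apply/matrixP => i j; rewrite !mxE.
rewrite trmx_mul !(mulmxDl, mulmxDr) -!(scalemxAl, scalemxAr).
by rewrite !mulmxA !mxE; ring.
Qed.

(** Each defect D k - D k.+1 - J k, tested against the k-th point of the Euler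
    scheme, is compared with the change of the quadratic form of D along the
    scheme; the changes telescope, and what remains in each step is J k minus
    the discrete version of a^T D + D a. *)
Lemma euler_telescope (R : realType) (d : nat) (h : R) (D a J : nat -> 'M[R]_d)
    (x0 : 'cV[R]_d) (n : nat) (x := euler h a x0) :
  qform (D 0) x0 - \sum_(k < n) qform (D k - D k.+1 - J k) (x k) =
  qform (D n) (x n) + \sum_(k < n) (qform (J k) (x k) -
    h * (qform ((a k)^T *m D k.+1) (x k) + qform (D k.+1 *m a k) (x k)
         + h * qform (D k.+1) (a k *m x k))).
Proof.
elim: n => [|n IH]; first by rewrite !big_ord0 subr0 addr0.
rewrite !big_ord_recr /= opprD addrA IH !qformB.
rewrite [x n.+1]/(x n + h *: (a n *m x n)) qform_step; ring.
Qed.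

(** Discrete Gronwall bound: each step multiplies the norm by at most
    1 + d C h <= exp (d C h). *)
Lemma norm_euler (R : realType) (d : nat) (h C : R) (a : nat -> 'M[R]_d)
    (x0 : 'cV[R]_d) (k : nat) : 0 <= h -> 0 <= C ->
  (forall l, (l < k)%N -> `|a l| <= C) ->
  `|euler h a x0 k| <= expR (d%:R * C * (k%:R * h)) * `|x0|.
Proof.
move=> h0 C0; elim: k => [|k IH] aC.
  by rewrite mul0r mulr0 expR0 mul1r.
have {}IH := IH (fun l lk => aC l (ltnW lk)).
have -> : d%:R * C * (k.+1%:R * h) = d%:R * C * h + d%:R * C * (k%:R * h).
  by rewrite -natr1; ring.
rewrite expRD -mulrA /=.
apply: (@le_trans _ _ ((1 + d%:R * C * h) * `|euler h a x0 k|)).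
  rewrite mulrDl mul1r (le_trans (ler_normD _ _))// lerD2l normrZ ger0_norm//.
  rewrite [leRHS](_ : _ = h * (d%:R * C * `|euler h a x0 k|)); last by ring.
  rewrite ler_wpM2l// (le_trans (norm_mulmx _ _))//.
  by rewrite ler_wpM2r// ler_wpM2l// aC.
rewrite ler_pM// ?addr_ge0 ?mulr_ge0// expR_ge1Dx//.
Qed.

(** When D is the solution, J the integrals of its drift and a the coefficient at
    the grid points, the summands are noise increments tested against the scheme;
    this is the variable Z above. *)
Definition defect (R : realType) (d : nat) (h : R) (D a J : nat -> 'M[R]_d)
    (x0 : 'cV[R]_d) (n : nat) : R :=
  qform (D 0) x0 -
  \sum_(k < n) qform (D k - D k.+1 - J k) (euler h a x0 k).

Definition mx_integral (R : realType) (d : nat) (b : R -> 'M[R]_d) (s t : R) :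
    'M[R]_d :=
  \matrix_(i, j) \int[lebesgue_measure]_(r in `[s, t]) b r i j.

Definition drift (R : realType) (d : nat) (A D Q : R -> 'M[R]_d) (r : R) :
    'M[R]_d := (A r)^T *m D r + D r *m A r + Q r.

(** Only the term with Q is not small: the other two compare A and D at time r
    with their values As and Ds at the ends of the step, and the last one is of
    second order in h.  Symmetry of D turns x^T A^T D x into x^T D A x. *)
Lemma qform_drift_lower_bound (R : realType) (d : nat) (h C X delta : R)
    (A D Q As Ds : 'M[R]_d) (x : 'cV[R]_d) :
  0 <= h -> 0 <= C -> 0 <= X -> D^T = D -> Ds^T = Ds -> nonneg_definite Q ->
  `|A| <= C -> `|Ds| <= C -> `|As| <= C -> `|x| <= X ->
  `|A - As| <= delta -> `|D - Ds| <= delta ->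
  - (4 * d%:R ^+ 3 * X ^+ 2 * C * delta + h * (d%:R ^+ 2 * C * (d%:R * C * X) ^+ 2))
  <= qform (A^T *m D + D *m A + Q) x -
     (qform (As^T *m Ds) x + qform (Ds *m As) x + h * qform Ds (As *m x)).
Proof.
move=> h0 C0 X0 Dsym Dssym Q0 AC DsC AsC xX dA dD.
have sym (B S : 'M[R]_d) : S^T = S -> qform (B^T *m S) x = qform (S *m B) x.
  by move=> SE; rewrite -[RHS]qform_tr trmx_mul SE.
rewrite 2!qformD !sym//.
have -> : qform (D *m A) x + qform (D *m A) x + qform Q x -
    (qform (Ds *m As) x + qform (Ds *m As) x + h * qform Ds (As *m x)) =
    qform (D *m A - Ds *m As) x *+ 2 + qform Q x - h * qform Ds (As *m x).
  by rewrite qformB; ring.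
have delta0 : 0 <= delta by exact: le_trans dA.
have d0 : 0 <= d%:R :> R by [].
have n1 : `|D *m A - Ds *m As| <= 2 * d%:R * C * delta.
  have -> : D *m A - Ds *m As = (D - Ds) *m A + Ds *m (A - As).
    by rewrite mulmxBl mulmxBr addrA subrK.
  rewrite (le_trans (ler_normD _ _))//.
  rewrite (_ : 2 * _ * _ * _ = d%:R * delta * C + d%:R * C * delta); last by ring.
  rewrite lerD// (le_trans (norm_mulmx _ _))//.
    by rewrite ler_pM ?mulr_ge0// ler_wpM2l.
  by rewrite ler_pM// ?mulr_ge0// ler_wpM2l.
have x2 : `|x| ^+ 2 <= X ^+ 2 by rewrite ler_sqr ?nnegrE.
have q1 : `|qform (D *m A - Ds *m As) x| <= 2 * d%:R ^+ 3 * X ^+ 2 * C * delta.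
  rewrite (le_trans (norm_qform _ _))//.
  rewrite [leRHS](_ : _ = d%:R ^+ 2 * (2 * d%:R * C * delta) * X ^+ 2); last by ring.
  by rewrite ler_pM ?mulr_ge0 ?sqr_ge0// ler_wpM2l ?sqr_ge0.
have q2 : `|qform Ds (As *m x)| <= d%:R ^+ 2 * C * (d%:R * C * X) ^+ 2.
  rewrite (le_trans (norm_qform _ _))//.
  rewrite ler_pM ?mulr_ge0 ?sqr_ge0// ?ler_wpM2l ?sqr_ge0//.
  rewrite ler_sqr ?nnegrE ?mulr_ge0// (le_trans (norm_mulmx _ _))//.
  by rewrite ler_pM ?mulr_ge0// ler_wpM2l.
have q3 : h * qform Ds (As *m x) <= h * (d%:R ^+ 2 * C * (d%:R * C * X) ^+ 2).
  by rewrite ler_wpM2l// (le_trans (ler_norm _)).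
have q4 : 0 <= qform Q x by exact: Q0.
move: q1; rewrite ler_norml => /andP[q1 _].
move: q1 q3 q4.
rewrite (_ : 4 * _ * _ * _ * _ = (2 * d%:R ^+ 3 * X ^+ 2 * C * delta) *+ 2); last by ring.
move: (h * qform Ds (As *m x)) (h * (d%:R ^+ 2 * _ * _)) => u v.
move: (2 * d%:R ^+ 3 * X ^+ 2 * C * delta) (qform (D *m A - Ds *m As) x) => y z.
by move: (qform Q x) => q; lra.
Qed.

(** After telescoping, the first term is nonnegative because D (t n) is, and each
    step contributes the integral over [t k, t k.+1] of a function bounded below
    by qform_drift_lower_bound.  The bound is explicit in the oscillation delta so
    that it serves both as a uniform bound (delta = 2 C) and for the limit. *)
Lemma defect_lower_bound (R : realType) (d : nat) (t0 h C X delta : R) (n : nat)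
    (A D Q : R -> 'M[R]_d) (a : nat -> 'M[R]_d) (x0 : 'cV[R]_d)
    (t := fun k : nat => t0 + k%:R * h) :
  0 <= h -> 0 <= C -> 0 <= X ->
  (forall r, t0 <= r <= t n -> [/\ (D r)^T = D r, nonneg_definite (Q r),
      `|A r| <= C & `|D r| <= C]) ->
  nonneg_definite (D (t n)) ->
  (forall r s, t0 <= r <= t n -> t0 <= s <= t n -> `|r - s| <= h ->
      `|A r - A s| <= delta /\ `|D r - D s| <= delta) ->
  (forall k, (k < n)%N -> a k = A (t k)) ->
  (forall k, (k < n)%N -> `|euler h a x0 k| <= X) ->
  (forall i j, lebesgue_measure.-integrable `[t0, t n]
      (fun r => (drift A D Q r i j)%:E)) ->
  - (n%:R * h * (4 * d%:R ^+ 3 * X ^+ 2 * C * delta +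
                 h * (d%:R ^+ 2 * C * (d%:R * C * X) ^+ 2))) <=
  defect h (D \o t) a (fun k => mx_integral (drift A D Q) (t k) (t k.+1)) x0 n.
Proof.
move=> h0 C0 X0 hyp Dn osc aA xX bi.
rewrite /defect (@euler_telescope R d h (D \o t) a
  (fun k => mx_integral (drift A D Q) (t k) (t k.+1)) x0 n) /=.
set c := 4 * _ * _ * _ * _ + _.
rewrite -[leLHS]add0r lerD//; first exact: Dn.
rewrite -mulrA mulr_natl -[n in X in X <= _]card_ord -mulNrn -sumr_const.
apply: ler_sum => -[k kn] _ /=.
have tk1 : t k <= t k.+1.
  by rewrite /t lerD2l ler_wpM2r// ler_nat.
have tk0 : t0 <= t k by rewrite lerDl mulr_ge0.
have tkn : t k.+1 <= t n by rewrite /t lerD2l ler_wpM2r// ler_nat.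
have sub : `[t k, t k.+1] `<=` `[t0, t n].
  by apply: subset_itv; rewrite bnd_simp.
have inn r : t k <= r <= t k.+1 -> t0 <= r <= t n.
  by move=> /andP[r1 r2]; rewrite (le_trans tk0 r1) (le_trans r2 tkn).
have hk : t k.+1 - t k = h by rewrite /t -natr1; ring.
have bik i j : lebesgue_measure.-integrable `[t k, t k.+1]
    (fun r => (drift A D Q r i j)%:E).
  by apply: integrableS (bi i j).
have [/= qi ->] := @qform_integral R d `[t k, t k.+1] (measurable_itv _)
    (drift A D Q) (euler h a x0 k) bik.
set S := qform _ _ + _ + _.
rewrite lerBrDl.
have -> : h * S + - (h * c) = \int[lebesgue_measure]_(r in `[t k, t k.+1]) (S - c).
  rewrite Rintegral_cst// /lebesgue_measure /= lebesgue_measure_itv /= lte_fin.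
  move: tk1; rewrite le_eqVlt => /predU1P[E|->] /=.
    have -> : h = 0 by rewrite -hk E subrr.
    by rewrite E ltxx /=; ring.
  by rewrite hk; ring.
apply: le_Rintegral => //.
- apply: continuous_compact_integrable; first exact: segment_compact.
  exact/continuous_subspaceT/cst_continuous.
move=> r; rewrite /= in_itv /= => rk.
have tkk : t0 <= t k <= t n by rewrite tk0 (le_trans tk1 tkn).
have tk1n : t0 <= t k.+1 <= t n by rewrite tkn (le_trans tk0 tk1).
have [Dr Qr Ar _] := hyp r (inn r rk).
have [_ _ Ak _] := hyp _ tkk.
have [Dk _ _ Dkn] := hyp _ tk1n.
have [dA _] : `|A r - A (t k)| <= delta /\ `|D r - D (t k)| <= delta.
  apply: osc => //; first exact: inn.
  by case/andP: rk => r1 r2; rewrite ger0_norm ?subr_ge0// -hk lerD2r.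
have [_ dD] : `|A r - A (t k.+1)| <= delta /\ `|D r - D (t k.+1)| <= delta.
  apply: osc => //; first exact: inn.
  by case/andP: rk => r1 r2; rewrite distrC ger0_norm ?subr_ge0// -hk lerD2l lerN2.
have := qform_drift_lower_bound h0 C0 X0 Dr Dk Qr Ar Dkn Ak (xX _ kn) dA dD.
by rewrite -/c lerBrDl /S aA.
Qed.

(** Heine's theorem, phrased with a filter of mesh sizes. *)
Lemma uniform_continuity_itv (R : realType) (V : normedModType R) (a b : R)
    (f : R -> V) (e : R) : 0 < e ->
  {within `[a, b], continuous f} ->
  \forall h \near 0^'+, forall r s, a <= r <= b -> a <= s <= b ->
    `|r - s| <= h -> `|f r - f s| <= e.
Proof.
move=> e0 /subspace_continuousP cf.
have /compact_near_coveringP/near_covering_withinP cov := @segment_compact R a b.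
have : \forall h \near 0^'+, `[a, b] `<=`
    (fun r => forall s, a <= s <= b -> `|r - s| <= h -> `|f r - f s| <= e).
  apply: cov => x xab.
  have /cvgrPdist_lt/(_ (e / 2) (divr_gt0 e0 (ltr0n _ 2))) := cf x xab.
  rewrite near_withinE /= => /nbhs_ballP[r /= r0 xr].
  have r20 : 0 < r / 2 by rewrite divr_gt0.
  exists (ball x (r / 2), [set h | h < r / 2]).
    split; first exact: nbhsx_ballx.
    by apply: nbhs_right_lt.
  move=> [y h] /= [xy hr] yab s sab ysh.
  have xs : ball x r s.
    rewrite /ball /= in xy *.
    have : `|x - s| <= `|x - y| + `|y - s| by rewrite (le_trans _ (ler_normD _ _))// addrA subrK.
    by move: xy hr ysh; lra.
  have yr : ball x r y.
    by apply: le_ball xy; lra.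
  have := xr _ yr yab.
  have sab' : s \in `[a, b] by rewrite in_itv.
  have := xr _ xs sab'; rewrite /from_subspace.
  have : `|f y - f s| <= `|f x - f y| + `|f x - f s|.
    rewrite -(normrN (f x - f y)) opprB (le_trans _ (ler_normD _ _))//.
    by rewrite addrA subrK.
  lra.
apply: filterS => h H r s rab sab; apply: H => //.
Qed.

Lemma cvg_mx_entries (R : realType) (U : Type) (F : set_system U) (FF : Filter F)
    (m n : nat) (f : U -> 'M[R]_(m, n)) (A : 'M[R]_(m, n)) :
  (forall i j, f x i j @[x --> F] --> A i j) -> f x @[x --> F] --> A.
Proof.
move=> fA; apply/cvgrPdist_le => e e0.
have : \forall x \near F, forall ij : 'I_m * 'I_n,
    `|A ij.1 ij.2 - f x ij.1 ij.2| <= e.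
  apply: filter_forall => -[i j] /=.
  by have /cvgrPdist_le := fA i j; exact.
apply: filterS => x Hx; apply: mx_norm_le; first exact: ltW.
by move=> i j; have := Hx (i, j); rewrite !mxE.
Qed.

Lemma cvg_mx_entry (R : realType) (U : Type) (F : set_system U) (FF : Filter F)
    (m n : nat) (f : U -> 'M[R]_(m, n)) (A : 'M[R]_(m, n)) i j :
  f x @[x --> F] --> A -> f x i j @[x --> F] --> A i j.
Proof.
by move=> fA; apply: (cvg_comp _ (fun M : 'M[R]_(m, n) => M i j) fA);
  exact: coord_continuous.
Qed.

Lemma cvg_mulmx (R : realType) (U : Type) (F : set_system U) (FF : Filter F)
    (m n p : nat) (f : U -> 'M[R]_(m, n)) (g : U -> 'M[R]_(n, p))
    (A : 'M[R]_(m, n)) (B : 'M[R]_(n, p)) :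
  f x @[x --> F] --> A -> g x @[x --> F] --> B ->
  f x *m g x @[x --> F] --> A *m B.
Proof.
move=> fA gB; apply: cvg_mx_entries => i j; rewrite mxE.
under eq_fun do rewrite mxE.
by apply: (@cvg_big _ _ _ _ _ add_continuous) => k _; apply: cvgM; apply: cvg_mx_entry.
Qed.

Lemma cvg_trmx (R : realType) (U : Type) (F : set_system U) (FF : Filter F)
    (m n : nat) (f : U -> 'M[R]_(m, n)) (A : 'M[R]_(m, n)) :
  f x @[x --> F] --> A -> (f x)^T @[x --> F] --> A^T.
Proof.
move=> fA; apply: cvg_mx_entries => i j; rewrite mxE.
by under eq_fun do rewrite mxE; exact: cvg_mx_entry.
Qed.

Lemma within_continuous_trmx (R : realType) (D : set R) (d : nat)
    (f : R -> 'M[R]_d) :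
  {within D, continuous f} -> {within D, continuous (fun r => (f r)^T)}.
Proof. by move=> cf x; apply: cvg_trmx; exact: cf. Qed.

Lemma integrable_continuous_entry (R : realType) (a b : R) (d : nat)
    (f : R -> 'M[R]_d) i j : {within `[a, b], continuous f} ->
  lebesgue_measure.-integrable `[a, b] (fun r => (f r i j)%:E).
Proof.
move=> cf; apply: (@continuous_compact_integrable R (fun r => f r i j)).
  exact: segment_compact.
by move=> x; apply: cvg_mx_entry; exact: cf.
Qed.

(** Refining the grid on [t0, T]: the defects are bounded below by a constant that
    depends only on the bounds on the data, as dominated convergence requires,
    and their inferior limit is nonnegative. *)
Lemma defect_bounds (R : realType) (d : nat) (t0 T C X0 : R)
    (A D Q : R -> 'M[R]_d) (a : nat -> nat -> 'M[R]_d) (x0 : 'cV[R]_d)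
    (h := fun n : nat => (T - t0) / n.+1%:R)
    (t := fun n k : nat => t0 + k%:R * h n)
    (Z := fun n => defect (h n) (D \o t n) (a n)
            (fun k => mx_integral (drift A D Q) (t n k) (t n k.+1)) x0 n.+1)
    (X := expR (d%:R * C * (T - t0)) * X0) :
  t0 <= T -> 0 <= C -> `|x0| <= X0 ->
  (forall r, t0 <= r <= T -> [/\ (D r)^T = D r, nonneg_definite (Q r),
      `|A r| <= C & `|D r| <= C]) ->
  nonneg_definite (D T) ->
  {within `[t0, T], continuous A} -> {within `[t0, T], continuous D} ->
  {within `[t0, T], continuous Q} ->
  (forall n k, (k <= n)%N -> a n k = A (t n k)) ->
  (forall n, - ((T - t0) * (4 * d%:R ^+ 3 * X ^+ 2 * C * (C + C) +
                 (T - t0) * (d%:R ^+ 2 * C * (d%:R * C * X) ^+ 2))) <= Z n) /\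
  (forall e, 0 < e -> \forall n \near \oo, - e <= Z n).
Proof.
move=> t0T C0 x0X hyp DT cA cD cQ aA.
have T0 : 0 <= T - t0 by rewrite subr_ge0.
have h0 n : 0 <= h n by rewrite divr_ge0.
have X0' : 0 <= X by rewrite mulr_ge0 ?expR_ge0// (le_trans _ x0X).
have hn n : n.+1%:R * h n = T - t0 by rewrite /h mulrC divfK// pnatr_eq0.
have tn n : t n n.+1 = T by rewrite /t hn addrC subrK.
have tkT n k : (k <= n)%N -> t0 <= t n k <= T.
  move=> kn; rewrite lerDl mulr_ge0//= -(tn n) lerD2l ler_wpM2r// ler_nat.
  exact: leqW.
have cdrift : {within `[t0, T], continuous (drift A D Q)}.
  move=> x; apply: cvgD; last exact: cQ.
  apply: cvgD; apply: cvg_mulmx; [|exact: cD|exact: cD|exact: cA].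
  exact: within_continuous_trmx.
have bnd n delta : (forall r s, t0 <= r <= T -> t0 <= s <= T -> `|r - s| <= h n ->
      `|A r - A s| <= delta /\ `|D r - D s| <= delta) ->
    - ((T - t0) * (4 * d%:R ^+ 3 * X ^+ 2 * C * delta +
                 h n * (d%:R ^+ 2 * C * (d%:R * C * X) ^+ 2))) <= Z n.
  move=> osc; rewrite -(hn n) /Z.
  apply: defect_lower_bound => //; rewrite ?[t0 + n.+1%:R * h n](tn n)//.
  - by move=> k kn; exact: aA.
  - move=> k kn; apply: le_trans (norm_euler _ _ (C := C) _ _) _ => //.
    + move=> l lk; rewrite aA; last by rewrite -ltnS (ltn_trans lk kn).
      by case: (hyp (t n l)) => //; apply: tkT; rewrite -ltnS (ltn_trans lk kn).
    + rewrite ler_pM ?expR_ge0// ler_expR ler_wpM2l ?mulr_ge0//.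
      by rewrite -(hn n) ler_wpM2r// ler_nat ltnW.
  - by move=> i j; exact: integrable_continuous_entry.
split=> [n|e e0].
  apply: le_trans (bnd n (C + C) _).
    rewrite lerN2 ler_wpM2l// lerD2l ler_wpM2r//.
      by rewrite mulr_ge0 ?sqr_ge0// mulr_ge0// sqr_ge0.
    by rewrite ler_pdivrMr// ler_peMr// ler1n.
  move=> r s rT sT _; have [_ _ Ar Dr] := hyp r rT; have [_ _ As Ds] := hyp s sT.
  by split; rewrite (le_trans (ler_normB _ _))// lerD.
set u := 4 * d%:R ^+ 3 * X ^+ 2 * C; set v := d%:R ^+ 2 * C * (d%:R * C * X) ^+ 2.
have u0 : 0 <= u by rewrite mulr_ge0// mulr_ge0 ?sqr_ge0// mulr_ge0// exprn_ge0.
have v0 : 0 <= v by rewrite mulr_ge0 ?sqr_ge0// mulr_ge0// sqr_ge0.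
(* with oscillation and step at most e / w, the bound is (w - 1) e / w <= e *)
set w := 1 + (T - t0) * (u + v).
have w0 : 0 < w by rewrite ltr_pwDl// mulr_ge0// addr_ge0.
have ew : 0 < e / w by rewrite divr_gt0.
have hcvg : h n @[n --> \oo] --> (0 : R).
  rewrite /h -[X in _ --> X](mulr0 (T - t0)); apply: cvgM; first exact: cvg_cst.
  exact: cvg_harmonic.
have toright (P : R -> Prop) : (forall g g', 0 <= g <= g' -> P g' -> P g) ->
    (\forall g \near 0^'+, P g) -> \forall n \near \oo, P (h n).
  move=> mono /nbhs_right0P-[g /= g0 Pg].
  have /cvgr0Pnorm_lt /(_ (g / 2) (divr_gt0 g0 (ltr0n _ 2))) := hcvg.
  apply: filterS => n; rewrite ger0_norm// => hng.
  apply: (mono _ (g / 2)); first by rewrite h0 ltW.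
  have g2 : 0 < g / 2 by rewrite divr_gt0.
  rewrite -[g / 2]add0r; apply: Pg g2.
  by rewrite /ball /= sub0r normrN ger0_norm ?ltW ?divr_gt0// ltr_pdivrMr// ltr_pMr// ltr1n.
have osc (p q : nat) (f : R -> 'M[R]_(p, q)) : {within `[t0, T], continuous f} -> \forall n \near \oo,
    forall r s : R, t0 <= r <= T -> t0 <= s <= T -> `|r - s| <= h n ->
      `|f r - f s| <= e / w :> R.
  move=> cf; apply: (toright (fun g => forall r s : R, t0 <= r <= T ->
    t0 <= s <= T -> `|r - s| <= g -> `|f r - f s| <= e / w)).
    move=> g g' /andP[_ gg'] H r s rT sT rs; apply: H => //.
    exact: le_trans gg'.
  exact: (uniform_continuity_itv ew cf).
have hsmall : \forall n \near \oo, h n <= e / w.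
  have /cvgr0Pnorm_le /(_ _ ew) := hcvg.
  by apply: filterS => n; rewrite ger0_norm.
apply: filterS3 (osc _ _ _ cA) (osc _ _ _ cD) hsmall => n oscA oscD hn'.
apply: le_trans (bnd n (e / w) _).
  rewrite lerN2 -/u -/v (@le_trans _ _ ((T - t0) * (u * (e / w) + e / w * v)))//.
    by rewrite ler_wpM2l// lerD2l ler_wpM2r.
  rewrite (_ : _ * _ = (w - 1) * (e / w)); last by rewrite /w; ring.
  by rewrite mulrBl mul1r mulrCA divff ?gt_eqF// mulr1 lerBlDr lerDl ltW.
by move=> r s rT sT rs; split; [exact: oscA|exact: oscD].
Qed.

(** * The first moment of the normal law *)

(** The measure is the sum of its restrictions to A and to the complement of A,
    and the second one does not see the function cut off outside A. *)
Lemma ge0_integral_mrestr d (T : measurableType d) (R : realType)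
    (mu : {measure set T -> \bar R}) (A : set T) (mA : measurable A)
    (f : T -> \bar R) : (forall x, (0 <= f x)%E) -> measurable_fun setT f ->
  (\int[mrestr mu mA]_x f x = \int[mu]_(x in A) f x)%E.
Proof.
move=> f0 mf; have mAc : measurable (~` A) by exact: measurableC.
have mg : measurable_fun setT (f \_ A).
  by apply/(measurable_restrictT _ mA); exact: measurable_funTS.
have g0 x : (0 <= (f \_ A) x)%E by rewrite patchE; case: ifP.
rewrite [RHS]integral_mkcond.
pose nu := measure_add (mrestr mu mA) (mrestr mu mAc).
have muE B : measurable B -> mu B = nu B.
  move=> mB; rewrite /nu measure_addE /= /mrestr -measureU.
  - by rewrite -setIUr setUv setIT.
  - exact: measurableI.
  - exact: measurableI.
  - by rewrite setIACA setICr !setI0.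
rewrite (eq_measure_integral nu); last by move=> B mB _; exact: muE.
rewrite ge0_integral_measure_add//.
rewrite [X in (_ + X)%E](_ : _ = 0%E) ?adde0; last first.
  rewrite -[RHS](integral0 (mrestr mu mAc) setT); apply: ae_eq_integral => //.
  exists A; split => //; first by rewrite /= /mrestr setICr measure0.
  by move=> x /= /not_implyP[_]; rewrite patchE; case: ifPn => // /set_mem.
apply: ae_eq_integral => //; exists (~` A); split => //.
  by rewrite /= /mrestr setICl measure0.
move=> x /= /not_implyP[_]; rewrite patchE; case: ifPn => // /negP xA _ Ax.
by apply: xA; exact: mem_set.
Qed.

(** The density of the normal law is its Radon-Nikodym derivative, by uniqueness of
    the latter. *)
Lemma ge0_integral_normal (R : realType) (m s : R) (f : R -> \bar R) :
  (forall x, (0 <= f x)%E) -> measurable_fun setT f ->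
  (\int[normal_prob m s]_x f x =
   \int[lebesgue_measure]_x (f x * (normal_pdf m s x)%:E))%E.
Proof.
move=> f0 mf.
have dom := @normal_prob_dominates R m s.
rewrite -(Radon_Nikodym_SigmaFinite.change_of_variables dom)//.
have mpdf : measurable_fun setT (EFin \o normal_pdf m s).
  by apply/measurable_EFinP; exact: measurable_normal_pdf.
apply: ae_eq_integral => //.
- apply: emeasurable_funM => //.
  exact: measurable_int (Radon_Nikodym_SigmaFinite.f_integrable dom).
- exact: emeasurable_funM.
- apply: ae_eqe_mul2l; apply: integral_ae_eq => //.
  + exact: Radon_Nikodym_SigmaFinite.f_integrable.
  + move=> E _ mE.
    by rewrite -(Radon_Nikodym_SigmaFinite.f_integral dom).
Qed.

Lemma normal_pdf_centeredN (R : realType) (s : R) (x : R) : s != 0 ->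
  normal_pdf 0 s (- x) = normal_pdf 0 s x.
Proof. by move=> s0; rewrite !normal_pdfE// /normal_fun !subr0 sqrrN. Qed.

(** The density is even, so x |-> - x exchanges the two half-lines.  Together with
    finiteness of the first moment, this says that the centered normal law has
    mean zero. *)
Lemma integral_normal_sym (R : realType) (s : R) : s != 0 ->
  (\int[normal_prob 0 s]_x (Num.max (- x) 0)%:E =
   \int[normal_prob 0 s]_x (Num.max x 0)%:E)%E.
Proof.
move=> s0.
have mneg : measurable_fun setT (fun x : R => Num.max (- x) 0).
  by apply: measurable_maxr => //; exact: oppr_measurable.
have mpos : measurable_fun setT (fun x : R => Num.max x 0).
  exact: measurable_maxr.
rewrite !ge0_integral_normal//; [|by move=> x; rewrite lee_fin le_max lexx orbT|
  exact/measurable_EFinP|by move=> x; rewrite lee_fin le_max lexx orbT|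
  exact/measurable_EFinP].
pose G (x : R) : R := Num.max (- x) 0 * normal_pdf 0 s x.
have cG : continuous G.
  move=> x; apply: cvgM; last exact: continuous_normal_pdf.
  apply: (@continuous_max _ _ (fun x => - x) (fun=> 0)).
    exact: oppr_continuous.
  exact: cst_continuous.
transitivity (\int[lebesgue_measure]_(x in `]-oo, (- 0)%R]) (G x)%:E)%E.
  rewrite [RHS]integral_mkcond; apply: eq_integral => x _.
  rewrite patchE /G oppr0; case: ifPn; first by rewrite EFinM.
  rewrite notin_setE /= in_itv /= => /negP; rewrite -ltNge => x0.
  by rewrite max_r ?mul0e// oppr_le0 ltW.
rewrite ge0_integration_by_substitutionNy//; last 2 first.
- exact: continuous_subspaceT.
- by move=> x _; rewrite mulr_ge0 ?normal_pdf_ge0// le_max lexx orbT.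
rewrite [LHS]integral_mkcond; apply: eq_integral => x _.
rewrite patchE /G /=; case: ifPn.
  by rewrite opprK normal_pdf_centeredN// EFinM.
rewrite notin_setE /= in_itv /= andbT => /negP; rewrite -ltNge => x0.
by rewrite max_r ?mul0e// ltW.
Qed.

(** Since |x| <= 1 + x^2 is dominated by a Gaussian growth factor, |x| times the
    density of standard deviation s is bounded by a multiple of the density of
    standard deviation 2 s, which is integrable. *)
Lemma normal_abs_moment (R : realType) (s : R) : s != 0 ->
  (\int[normal_prob 0 s]_x `|x|%:E < +oo)%E.
Proof.
move=> s0; have s2 : s *+ 2 != 0 by rewrite mulrn_eq0.
rewrite ge0_integral_normal//; last first.
  by apply/measurable_EFinP; exact: normr_measurable.
(* 3 / (8 s^2) is the difference of the exponents 1 / (2 s^2) and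
   1 / (2 (2 s)^2), and 1 + x^2 <= (1 + 8 s^2 / 3) (1 + 3 x^2 / (8 s^2)) *)
pose K := (1 + s ^+ 2 *+ 8 / 3) * (normal_peak s / normal_peak (s *+ 2)).
have K0 : 0 <= K by rewrite mulr_ge0 ?divr_ge0 ?normal_peak_ge0// addr_ge0// divr_ge0// mulrn_wge0 ?sqr_ge0.
have bound x : `|x| * normal_pdf 0 s x <= K * normal_pdf 0 (s *+ 2) x.
  rewrite !normal_pdfE//=.
  have p0 : 0 < normal_peak (s *+ 2) by exact: normal_peak_gt0.
  have q0 := normal_peak_ge0 s.
  rewrite /K (_ : _ * _ * (_ * _) = normal_peak s *
    ((1 + s ^+ 2 *+ 8 / 3) * normal_fun 0 (s *+ 2) x)); last by field; rewrite gt_eqF.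
  rewrite mulrCA ler_wpM2l//.
  have s20 : 0 < s ^+ 2 by rewrite exprn_even_gt0.
  have -> : normal_fun 0 s x =
      expR (- (x ^+ 2 * 3 / (s ^+ 2 *+ 8))) * normal_fun 0 (s *+ 2) x.
    rewrite /normal_fun -expRD !subr0; congr expR.
    by field; rewrite s0.
  rewrite mulrA ler_wpM2r ?expR_ge0// expRN ler_pdivrMr ?expR_gt0//.
  apply: (@le_trans _ _ ((1 + s ^+ 2 *+ 8 / 3) * (1 + x ^+ 2 * 3 / (s ^+ 2 *+ 8)))).
    have s80 : 0 < s ^+ 2 *+ 8 by rewrite mulrn_wgt0.
    move: (s ^+ 2 *+ 8) s80 => u u0.
    have -> : (1 + u / 3) * (1 + x ^+ 2 * 3 / u) = 1 + u / 3 + x ^+ 2 * 3 / u + x ^+ 2.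
      by field; rewrite gt_eqF.
    have : 0 <= x ^+ 2 * 3 / u 
      by apply: divr_ge0 (ltW u0); apply: mulr_ge0 => //; exact: sqr_ge0.
    have : 0 <= u / 3 by rewrite divr_ge0 ?(ltW u0).
    have : `|x| ^+ 2 = x ^+ 2 by rewrite real_normK ?num_real.
    have := sqr_ge0 x; have := sqr_ge0 (`|x| - 1).
    rewrite (_ : (`|x| - 1) ^+ 2 = `|x| ^+ 2 - 2 * `|x| + 1); last by ring.
    move: (x ^+ 2 * 3 / u) (u / 3) (x ^+ 2) (`|x| ^+ 2) (`|x|) => *; lra.
  rewrite ler_wpM2l ?expR_ge1Dx// addr_ge0// divr_ge0// mulrn_wge0//.
  exact: ltW.
apply: (@le_lt_trans _ _ (\int[lebesgue_measure]_x
    (K%:E * (normal_pdf 0 (s *+ 2) x)%:E))%E).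
  apply: ge0_le_integral => //.
  - by move=> x _; rewrite mule_ge0// lee_fin normal_pdf_ge0.
  - apply/measurable_EFinP; apply: measurable_funM; last exact: measurable_normal_pdf.
    exact: normr_measurable.
  - apply/measurable_EFinP; apply: measurable_funM => //.
    exact: measurable_normal_pdf.
  - by move=> x _; rewrite -!EFinM lee_fin.
rewrite ge0_integralZl//; last 2 first.
- by apply/measurable_EFinP; exact: measurable_normal_pdf.
- by move=> x _; rewrite lee_fin normal_pdf_ge0.
- by rewrite integral_normal_pdf mule1 ltry.
Qed.

(** * The completed filtration and the Brownian increments *)

Lemma natural_filtration_le (R : realType) disp (Omega : measurableType disp)
    (W : R -> Omega -> R) (s t : R) : s <= t ->
  natural_filtration W s `<=` natural_filtration W t.
Proof.
move=> st; apply: sub_smallest2r; first exact: smallest_sigma_algebra.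
move=> A [r /andP[r0 rs] [B mB AE]]; exists r; last by exists B.
by rewrite r0 (le_trans rs st).
Qed.

Lemma completed_filtration_le (R : realType) disp (Omega : measurableType disp)
    (P : probability Omega R) (W : R -> Omega -> R) (s t : R) : s <= t ->
  completed_filtration P W s `<=` completed_filtration P W t.
Proof.
move=> st; apply: sub_smallest2r; first exact: smallest_sigma_algebra.
by apply: setSU; exact: natural_filtration_le.
Qed.

(** The sets that agree with a set of the natural filtration up to a null set form
    a sigma-algebra containing the generators of the completed filtration.  This
    is how independence of the increments passes to the completion. *)
Lemma completed_filtration_natural (R : realType) disp
    (Omega : measurableType disp) (P : probability Omega R)
    (W : R -> Omega -> R) (t : R) (A : set Omega) :
  completed_filtration P W t A ->
  exists2 A', natural_filtration W t A' &
    P.-negligible ((A `\` A') `|` (A' `\` A)).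
Proof.
pose S := [set A | exists2 A', natural_filtration W t A' &
    P.-negligible ((A `\` A') `|` (A' `\` A))].
have sN : sigma_algebra setT (natural_filtration W t).
  exact: smallest_sigma_algebra.
have sS : sigma_algebra setT S.
  split.
  - exists set0; first by case: sN.
    by rewrite setDv setU0; exact: negligible_set0.
  - move=> B [B' nB' nB]; exists (setT `\` B'); first by case: sN => _ + _; apply.
    apply: negligibleS nB => w.
    rewrite /= => -[[[_ Bw] H]|[[_ Bw] H]].
      by right; split => //; apply: contrapT => H'; apply: H.
    by left; split => //; apply: contrapT => H'; apply: H.
  - move=> B BS; have /choice[B' B'E] : forall n, exists B', natural_filtration W t B'
        /\ P.-negligible ((B n `\` B') `|` (B' `\` B n)).
      by move=> n; have [B' ? ?] := BS n; exists B'.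
    exists (\bigcup_n B' n).
      by case: sN => _ _; apply => n; case: (B'E n).
    apply: (@negligibleS _ _ _ _ (\bigcup_n ((B n `\` B' n) `|` (B' n `\` B n)))).
      move=> w [[[n _ Bw] H]|[[n _ Bw] H]]; exists n => //.
        by left; split => // H'; apply: H; exists n.
      by right; split => // H'; apply: H; exists n.
    by apply: negligible_bigcup => n; case: (B'E n).
apply: (smallest_sub sS) => B [nB|nB].
  by exists B => //; rewrite setDv setU0; exact: negligible_set0.
exists set0; first by case: sN.
by rewrite setD0 set0D setU0.
Qed.

Lemma negligible_completed (R : realType) disp (Omega : measurableType disp)
    (P : probability Omega R) (W : R -> Omega -> R) (t : R) (A : set Omega) :
  P.-negligible A -> completed_filtration P W t A.
Proof. by move=> nA; apply: sub_sigma_algebra; right. Qed.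

(** The event is the section at time u of a set of the product sigma-algebra. *)
Lemma progressively_measurable_wrt (R : realType) disp
    (Omega : measurableType disp) (P : probability Omega R) (T : R)
    (W : R -> Omega -> R) (f : R -> Omega -> R) (u : R) :
  progressively_measurable T (completed_filtration P W) f -> 0 <= u <= T ->
  measurable_wrt (completed_filtration P W u) (f u).
Proof.
move=> pf uT B mB; have := pf u uT B mB.
set E := [set p : R * Omega | 0 <= p.1 <= u /\ B (f p.1 p.2)].
have -> : f u @^-1` B = [set w | E (u, w)].
  apply/seteqP; split=> w /=; last by case.
  by move=> Bw; split=> //=; move: uT => /andP[->]; rewrite lexx.
have [G0 GD GU] : sigma_algebra setT (completed_filtration P W u).
  exact: smallest_sigma_algebra.
suff sec : <<s [set E | exists (A : set R) (C : set Omega),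
    [/\ measurable A, completed_filtration P W u C & E = A `*` C] ] >> `<=`
    [set E | completed_filtration P W u [set w | E (u, w)] ] by exact: sec.
apply: smallest_sub => [|_ [A [C [mA FC ->]]] /=]; first split=> //=.
  - by move=> A hA; exact: (GD _ hA).
  - by move=> A hA; exact: (GU _ hA).
have [uA|uA] := pselect (A u).
  suff -> : [set w | (A `*` C) (u, w)] = C by [].
  by apply/seteqP; split => [w []|w Cw] //.
suff -> : [set w | (A `*` C) (u, w)] = set0 by [].
by apply/seteqP; split => [w []|w].
Qed.

Lemma ge0_integral_law d d' (T : measurableType d) (U : measurableType d')
    (R : realType) (mu : {measure set T -> \bar R})
    (nu : {measure set U -> \bar R}) (X : T -> U) (g : U -> \bar R) :
  measurable_fun setT X -> (forall B, measurable B -> nu B = mu (X @^-1` B)) ->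
  measurable_fun setT g -> (forall x, (0 <= g x)%E) ->
  (\int[nu]_x g x = \int[mu]_x g (X x))%E.
Proof.
move=> mX law mg g0.
pose Xm : {mfun T >-> U} := HB.pack X (isMeasurableFun.Build _ _ _ _ X mX).
transitivity (\int[pushforward mu Xm]_x g x)%E.
  by apply: eq_measure_integral => B mB _; exact: law.
by rewrite ge0_integral_pushforward.
Qed.

(** Independence says that on an event A of the past the increment has the law
    P A times the normal law; integrate g against both sides. *)
Lemma ge0_integral_increment (R : realType) disp (Omega : measurableType disp)
    (P : probability Omega R) (T : R) (W : R -> Omega -> R)
    (hW : standard_brownian_motion P T W) (s t : R) :
  0 <= s -> s < t -> t <= T ->
  let D := fun w => W t w - W s w in
  measurable_fun setT D /\
  forall (A : set Omega) (g : R -> \bar R), natural_filtration W s A ->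
    measurable A -> (forall x, (0 <= g x)%E) -> measurable_fun setT g ->
    (\int[P]_(w in A) g (D w) =
       P A * \int[normal_prob 0 (Num.sqrt (t - s))]_x g x)%E.
Proof.
move=> s0 st tT D; case: hW => mW _ _ law indep.
have sT : 0 <= s <= T by rewrite s0 (le_trans (ltW st)).
have t0 : 0 <= t <= T by rewrite tT (le_trans s0 (ltW st)).
have mD : measurable_fun setT D by apply: measurable_funB; exact: mW.
split=> // A g nA mA g0 mg.
rewrite -(@ge0_integral_mrestr _ _ _ P A mA (g \o D)); last 2 first.
- by move=> x /=.
- exact: measurableT_comp.
pose c : {nonneg R} := NngNum (fine_ge0 (measure_ge0 P A)).
have cE : (c%:num%:E = P A)%E by rewrite /= fineK//; exact: fin_num_measure.
have pA := ge0_integral_law mD (nu := mscale c (normal_prob 0 (Num.sqrt (t - s))))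
  (mu := mrestr P mA) _ mg g0.
rewrite -pA; first by rewrite ge0_integral_mscale// cE.
by move=> B mB; rewrite /= /mscale /mrestr /= setIC indep// law// -cE.
Qed.

(** The positive and the negative part of the increment have the same finite
    integral over A, by symmetry of the normal law. *)
Lemma increment_mean0_natural (R : realType) disp (Omega : measurableType disp)
    (P : probability Omega R) (T : R) (W : R -> Omega -> R)
    (hW : standard_brownian_motion P T W) (s t : R) :
  0 <= s -> s <= t -> t <= T ->
  P.-integrable setT (EFin \o (fun w => W t w - W s w)) /\
  forall A, natural_filtration W s A -> measurable A ->
    (\int[P]_(w in A) (W t w - W s w)%:E = 0)%E.
Proof.
move=> s0; rewrite le_eqVlt => /predU1P[<- _|st tT].
  rewrite (_ : EFin \o _ = cst 0%E); last by apply/funext => w /=; rewrite subrr.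
  split; first exact: integrable0.
  by move=> A _ _; under eq_integral do rewrite subrr; rewrite integral0.
have [mD H] := ge0_integral_increment hW s0 st tT.
have sig0 : Num.sqrt (t - s) != 0 by rewrite gt_eqF// sqrtr_gt0 subr_gt0.
have nT : natural_filtration W s setT.
  have [N0 ND _] : sigma_algebra setT (natural_filtration W s).
    exact: smallest_sigma_algebra.
  by have := ND _ N0; rewrite setD0.
have iD : P.-integrable setT (EFin \o (fun w => W t w - W s w)).
  apply/integrableP; split; first exact/measurable_EFinP.
  have := H setT (fun x => `|x|%:E) nT measurableT.
  rewrite /= => ->//; last by apply/measurable_EFinP; exact: normr_measurable.
  by rewrite probability_setT mul1e normal_abs_moment.
split=> // A nA mA.
have mmax : measurable_fun setT (fun x : R => (Num.max x 0)%:E).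
  by apply/measurable_EFinP; exact: measurable_maxr.
have mmin : measurable_fun setT (fun x : R => (Num.max (- x) 0)%:E).
  apply/measurable_EFinP; apply: measurable_maxr => //; exact: oppr_measurable.
rewrite integralE.
have Epos : (\int[P]_(w in A) ((fun w => (W t w - W s w)%:E) ^\+) w =
    P A * \int[normal_prob 0 (Num.sqrt (t - s))]_x (Num.max x 0)%:E)%E.
  rewrite -(H A (fun x => (Num.max x 0)%:E))//; last first.
    by move=> x; rewrite lee_fin le_max lexx orbT.
  by apply: eq_integral => w _; rewrite funeposE -EFin_max.
have Eneg : (\int[P]_(w in A) ((fun w => (W t w - W s w)%:E) ^\-) w =
    P A * \int[normal_prob 0 (Num.sqrt (t - s))]_x (Num.max (- x) 0)%:E)%E.
  rewrite -(H A (fun x => (Num.max (- x) 0)%:E))//; last first.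
    by move=> x; rewrite lee_fin le_max lexx orbT.
  by apply: eq_integral => w _; rewrite funenegE -EFinN -EFin_max.
rewrite Epos Eneg integral_normal_sym// subee// -Epos.
have iA : P.-integrable A (EFin \o (fun w => W t w - W s w)).
  exact: integrableS iD.
exact: integrable_pos_fin_num.
Qed.

Lemma increment_mean0 (R : realType) disp (Omega : measurableType disp)
    (P : probability Omega R) (T : R) (W : R -> Omega -> R)
    (hW : standard_brownian_motion P T W)
    (hFT : @measurable disp Omega = completed_filtration P W T) (s t : R) A :
  0 <= s -> s <= t -> t <= T -> completed_filtration P W s A ->
  (\int[P]_(w in A) (W t w - W s w)%:E = 0)%E.
Proof.
move=> s0 st tT cA.
have [iD H] := increment_mean0_natural hW s0 st tT.
have sT : s <= T by exact: le_trans tT.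
have mc B : completed_filtration P W s B -> measurable B.
  by rewrite hFT; exact: completed_filtration_le.
have [A' nA' negA] := completed_filtration_natural cA.
have mA' : measurable A' by apply: mc; apply: sub_sigma_algebra; left.
have mA : measurable A by exact: mc.
rewrite -(H A' nA' mA') integral_mkcond [RHS]integral_mkcond.
have mWD : measurable_fun setT (fun w => (W t w - W s w)%:E).
  exact: measurable_int iD.
apply: ae_eq_integral => //.
- by apply/(measurable_restrictT _ mA); exact: measurable_funTS.
- by apply/(measurable_restrictT _ mA'); exact: measurable_funTS.
apply: negligibleS negA => w /= /not_implyP[_]; rewrite !patchE.
have [/set_mem wA|/negP wA] := boolP (w \in A);
  have [/set_mem wA'|/negP wA'] := boolP (w \in A') => // _.
- by left; split => // /mem_set.
- by right; split => // /mem_set.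
Qed.

(** * Mean zero of the stochastic integral *)

(** Measurability with respect to a generated sigma-algebra is the library notion
    for the type equipped with it, whose closure properties then apply. *)
Lemma measurable_wrtP (R : realType) disp (Omega : measurableType disp)
    (U : set (set Omega)) (X : Omega -> R) :
  measurable_wrt <<s U >> X <->
  measurable_fun setT (X : g_sigma_algebraType U -> R).
Proof.
split=> [mX _ B mB|mX B mB]; first by rewrite setTI; exact: mX.
by have := mX measurableT B mB; rewrite setTI.
Qed.

Lemma measurable_wrtM (R : realType) disp (Omega : measurableType disp)
    (U : set (set Omega)) (X Y : Omega -> R) :
  measurable_wrt <<s U >> X -> measurable_wrt <<s U >> Y ->
  measurable_wrt <<s U >> (fun w => X w * Y w).
Proof.
by move=> /measurable_wrtP mX /measurable_wrtP mY; apply/measurable_wrtP;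
  exact: measurable_funM.
Qed.

Lemma measurable_wrtD (R : realType) disp (Omega : measurableType disp)
    (U : set (set Omega)) (X Y : Omega -> R) :
  measurable_wrt <<s U >> X -> measurable_wrt <<s U >> Y ->
  measurable_wrt <<s U >> (fun w => X w + Y w).
Proof.
by move=> /measurable_wrtP mX /measurable_wrtP mY; apply/measurable_wrtP;
  exact: measurable_funD.
Qed.

Lemma measurable_wrt_cst (R : realType) disp (Omega : measurableType disp)
    (U : set (set Omega)) (c : R) : measurable_wrt <<s U >> (fun _ => c).
Proof. by apply/measurable_wrtP; exact: measurable_cst. Qed.

Lemma measurable_wrtB (R : realType) disp (Omega : measurableType disp)
    (U : set (set Omega)) (X Y : Omega -> R) :
  measurable_wrt <<s U >> X -> measurable_wrt <<s U >> Y ->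
  measurable_wrt <<s U >> (fun w => X w - Y w).
Proof.
by move=> /measurable_wrtP mX /measurable_wrtP mY; apply/measurable_wrtP;
  exact: measurable_funB.
Qed.

Lemma measurable_wrt_sum (R : realType) disp (Omega : measurableType disp)
    (U : set (set Omega)) (n : nat) (X : 'I_n -> Omega -> R) :
  (forall i, measurable_wrt <<s U >> (X i)) ->
  measurable_wrt <<s U >> (fun w => \sum_(i < n) X i w).
Proof.
move=> mX; apply/measurable_wrtP.
by apply: measurable_sum => i; apply/measurable_wrtP; exact: mX.
Qed.

Lemma measurable_wrt_indic (R : realType) disp (Omega : measurableType disp)
    (U : set (set Omega)) (A : set Omega) :
  <<s U >> A -> measurable_wrt <<s U >> (\1_A : Omega -> R).
Proof.
move=> UA; apply/measurable_wrtP.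
exact: (@measurable_indic _ (g_sigma_algebraType U) R setT A UA).
Qed.

Lemma integrable_sub d (T : measurableType d) (R : realType)
    (mu : {measure set T -> \bar R}) (f g : T -> R) :
  mu.-integrable setT (EFin \o f) -> mu.-integrable setT (EFin \o g) ->
  mu.-integrable setT (EFin \o (fun x => f x - g x)).
Proof.
move=> fi gi; rewrite (_ : EFin \o _ = ((EFin \o f) \- (EFin \o g))%E)//.
exact: integrableB.
Qed.

Lemma integrable_boundedM d (T : measurableType d) (R : realType)
    (mu : {measure set T -> \bar R}) (f g : T -> R) (c : R) :
  measurable_fun setT f -> (forall x, `|f x| <= c) ->
  mu.-integrable setT (EFin \o g) ->
  mu.-integrable setT (EFin \o (fun x => f x * g x)).
Proof.
move=> mf fc ig.
have mg : measurable_fun setT g by apply/measurable_EFinP; exact: measurable_int ig.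
apply: (@le_integrable _ _ _ _ _ _ _ (fun x => (`|c|%:E * (EFin \o g) x)%E)) => //.
- by apply/measurable_EFinP; exact: measurable_funM.
- move=> x _ /=; rewrite lee_fin normrM normrM ler_wpM2r// normr_id.
  exact: le_trans (fc x) (ler_norm _).
- exact: integrableZl.
Qed.

(** For a value y in [-c, c], exactly one cell of the grid of mesh 1/(n+1) contains
    y, and the sum selects its left end. *)
Lemma grid_approximation (R : realType) (c y : R) (n : nat) :
  `|y| <= c ->
  `|y - \sum_(k < (Num.truncn (n.+1%:R * (c + c))).+1)
      (k%:R / n.+1%:R - c) *
      \1_[set z : R | k%:R / n.+1%:R - c <= z < k.+1%:R / n.+1%:R - c] y|
  <= n.+1%:R^-1.
Proof.
rewrite ler_norml => /andP[cy yc].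
have n0 : 0 < n.+1%:R :> R by rewrite ltr0n.
have yc0 : 0 <= n.+1%:R * (y + c) by rewrite mulr_ge0// -lerBlDr sub0r.
pose k0 := Num.truncn (n.+1%:R * (y + c)).
have /andP[k1 k2] := truncn_itv yc0.
have k0n : (k0 < (Num.truncn (n.+1%:R * (c + c))).+1)%N.
  by rewrite ltnS; apply: le_truncn; rewrite ler_wpM2l// lerD2r.
have mem (k : nat) : (y \in [set z : R | k%:R / n.+1%:R - c <= z < k.+1%:R / n.+1%:R - c]) = (k == k0).
  apply/idP/eqP => [/set_mem /= /andP[ky yk]|->]; last first.
    apply/mem_set => /=; rewrite lerBlDr ltrBrDr ler_pdivrMr// ltr_pdivlMr//.
    by rewrite ![(y + c) * _]mulrC k1 k2.
  apply/esym/truncn_def/andP; split.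
    by rewrite mulrC -ler_pdivrMr// -lerBlDr.
  by rewrite mulrC -ltr_pdivlMr// -ltrBrDr.
rewrite (bigD1 (Ordinal k0n))//= big1 ?addr0; last first.
  move=> k kk0; rewrite indicE mem (_ : (_ == _) = false) ?mulr0//.
  by apply/negbTE; apply: contra kk0 => /eqP kE; apply/eqP/val_inj.
rewrite indicE mem eqxx mulr1 opprB addrA ger0_norm.
  have e : k0%:R / n.+1%:R + n.+1%:R^-1 = k0.+1%:R / n.+1%:R :> R.
    by rewrite -[k0.+1%:R]natr1 mulrDl mul1r.
  by rewrite lerBlDl e ler_pdivlMr// mulrC ltW.
by rewrite subr_ge0 ler_pdivrMr// mulrC.
Qed.

(** The variable X is within 1/(n+1) of a combination of indicators of events of
    the sigma-algebra, against which D integrates to zero. *)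
Lemma bounded_mean0 (R : realType) disp (Omega : measurableType disp)
    (P : probability Omega R) (U : set (set Omega)) (D X : Omega -> R) (c : R) :
  (forall A, <<s U >> A -> measurable A) ->
  P.-integrable setT (EFin \o D) ->
  (forall A, <<s U >> A -> (\int[P]_(w in A) (D w)%:E = 0)%E) ->
  measurable_wrt <<s U >> X -> (forall w, `|X w| <= c) ->
  \int[P]_w (X w * D w) = 0.
Proof.
move=> mU iD D0 mX Xc.
have mXT : measurable_fun setT X by move=> _ B mB; rewrite setTI; apply: mU; exact: mX.
have iXD : P.-integrable setT (EFin \o (fun w => X w * D w)).
  exact: integrable_boundedM iD.
have iND : P.-integrable setT (EFin \o (fun w => `|D w|)) by exact: integrable_norm.
suff bnd n : `|\int[P]_w (X w * D w)| <= n.+1%:R^-1 * \int[P]_w `|D w|.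
  apply/eqP; rewrite -normr_le0; apply/ler_addgt0Pl => e e0; rewrite addr0.
  set I := \int[P]_w `|D w| in bnd.
  have I0 : 0 <= I by apply: Rintegral_ge0.
  have [n ne] : exists n : nat, I / e <= n.+1%:R.
    exists (Num.truncn (I / e)); apply/ltW; exact: truncnS_gt.
  apply: le_trans (bnd n) _.
  by rewrite mulrC ler_pdivrMr// mulrC -ler_pdivrMr.
pose E (k : nat) := X @^-1` [set z : R | k%:R / n.+1%:R - c <= z < k.+1%:R / n.+1%:R - c].
have UE k : <<s U >> (E k).
  apply: mX; rewrite (_ : [set z | _] = `[k%:R / n.+1%:R - c, k.+1%:R / n.+1%:R - c[%classic).
    exact: measurable_itv.
  by apply/seteqP; split => z /=; rewrite in_itv.
pose K := (Num.truncn (n.+1%:R * (c + c))).+1.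
pose Xn w := \sum_(k < K) (k%:R / n.+1%:R - c) * \1_(E k) w.
have iED (k : nat) : P.-integrable setT
    (EFin \o (fun w => (k%:R / n.+1%:R - c) * (\1_(E k) w * D w))).
  apply: (@integrable_boundedM _ _ _ P (cst _) _ `|k%:R / n.+1%:R - c|) => //.
  apply: (@integrable_boundedM _ _ _ P _ _ 1) => //.
    by apply: measurable_indic; exact: mU.
  by move=> w; rewrite indicE; case: (_ \in _); rewrite ?normr1 ?normr0.
have E0 (k : nat) : \int[P]_w ((k%:R / n.+1%:R - c) * (\1_(E k) w * D w)) = 0.
  rewrite RintegralZl//; last first.
    apply: (@integrable_boundedM _ _ _ P _ _ 1) => //.
      by apply: measurable_indic; exact: mU.
    by move=> w; rewrite indicE; case: (_ \in _); rewrite ?normr1 ?normr0.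
  rewrite [X in _ * X](_ : _ = 0) ?mulr0//.
  transitivity (\int[P]_(w in E k) D w); last by rewrite /Rintegral D0.
  rewrite [RHS]Rintegral_mkcond; apply: eq_Rintegral => w _.
  by rewrite patchE indicE; case: (_ \in _); rewrite ?mul1r ?mul0r.
have XnE w : Xn w * D w = \sum_(k < K) (k%:R / n.+1%:R - c) * (\1_(E k) w * D w).
  by rewrite mulr_suml; apply: eq_bigr => k _; rewrite mulrA.
have iXnD : P.-integrable setT (EFin \o (fun w => Xn w * D w)).
  rewrite (_ : (fun w => _) = fun w => \sum_(k < K)
      (k%:R / n.+1%:R - c) * (\1_(E k) w * D w)); last exact/funext.
  exact: integrable_sum_fin.
have Xn0 : \int[P]_w (Xn w * D w) = 0.
  under eq_Rintegral do rewrite XnE.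
  by rewrite Rintegral_sum// big1.
rewrite -[X in `|X|]subr0 -Xn0 -RintegralB//.
rewrite (le_trans (le_normr_Rintegral _ _))//.
  exact: integrable_sub.
rewrite -RintegralZl//; apply: le_Rintegral => //.
- by apply: integrable_norm; exact: integrable_sub.
- exact: (integrableZl measurableT n.+1%:R^-1 iND).
- move=> w _; rewrite -mulrBl normrM ler_wpM2r//.
  exact: grid_approximation.
Qed.

(** In each term, X times the coefficient is known at the left end of the time
    interval, and the increment of W has mean zero against it. *)
Lemma sp_integral_mean0 (R : realType) disp (Omega : measurableType disp)
    (P : probability Omega R) (T : R) (W : R -> Omega -> R)
    (hW : standard_brownian_motion P T W)
    (hFT : @measurable disp Omega = completed_filtration P W T) (t : R)
    (phi : simple_process R Omega) (X : Omega -> R) (c : R) :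
  0 <= t -> simple_process_on (completed_filtration P W) t T phi ->
  measurable_wrt (completed_filtration P W t) X -> (forall w, `|X w| <= c) ->
  P.-integrable setT (EFin \o sp_integral W phi) /\
  \int[P]_w (X w * sp_integral W phi w) = 0.
Proof.
move=> t0 [tau0 tauT tauS mcoef bcoef] mX Xc.
have tau_ge k : (k <= sp_size phi)%N -> t <= sp_time phi k.
  by elim: k => // k IH kn; rewrite (le_trans (IH (ltnW kn)))// tauS.
have tau_le k : (k <= sp_size phi)%N -> sp_time phi k <= T.
  move=> kn; apply: le_trans tauT.
  have -> : sp_size phi = (k + (sp_size phi - k))%N by rewrite subnKC.
  have : (sp_size phi - k <= sp_size phi - k)%N by [].
  elim: {-2}(sp_size phi - k)%N => [|m IH] mle; first by rewrite addn0.
  apply: le_trans (IH (ltnW mle)) _; rewrite addnS; apply: tauS.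
  by rewrite -(subnKC kn) ltn_add2l.
have mU s : s <= T -> forall A, completed_filtration P W s A -> measurable A.
  by move=> sT A; rewrite hFT; exact: completed_filtration_le.
have mXs k : (k < sp_size phi)%N ->
    measurable_wrt (completed_filtration P W (sp_time phi k)) X.
  move=> kn B mB; apply: (@completed_filtration_le _ _ _ _ _ t); last exact: mX.
  exact/tau_ge/ltnW.
pose D (k : nat) w := W (sp_time phi k.+1) w - W (sp_time phi k) w.
have iD (k : 'I_(sp_size phi)) : P.-integrable setT (EFin \o D k).
  apply: (increment_mean0_natural hW _ _ _).1.
  - exact: le_trans (tau_ge _ (ltnW (ltn_ord k))).
  - exact: tauS.
  - exact: tau_le.
have mwT (k : nat) (Y : Omega -> R) : (k < sp_size phi)%N ->
    measurable_wrt (completed_filtration P W (sp_time phi k)) Y ->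
    measurable_fun setT Y.
  move=> kn mY _ B mB; rewrite setTI; apply: (mU (sp_time phi k)); last exact: mY.
  exact/tau_le/ltnW.
have icD (k : 'I_(sp_size phi)) :
    P.-integrable setT (EFin \o (fun w => sp_coef phi k w * D k w)).
  have [C coefC] := bcoef k (ltn_ord k).
  apply: (integrable_boundedM _ coefC) => //.
  exact: (mwT _ _ (ltn_ord k) (mcoef _ _)).
split; first exact: integrable_sum_fin.
have iXcD (k : 'I_(sp_size phi)) :
    P.-integrable setT (EFin \o (fun w => X w * (sp_coef phi k w * D k w))).
  apply: (integrable_boundedM _ Xc) => //.
  exact: (mwT _ _ (ltn_ord k) (mXs _ (ltn_ord k))).
transitivity (\int[P]_w \sum_(k < sp_size phi) X w * (sp_coef phi k w * D k w)).
  by apply: eq_Rintegral => w _; rewrite mulr_sumr.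
rewrite Rintegral_sum// big1// => k _.
transitivity (\int[P]_w ((X w * sp_coef phi k w) * D k w)).
  by apply: eq_Rintegral => w _; rewrite mulrA.
have [C coefC] := bcoef k (ltn_ord k).
apply: (@bounded_mean0 _ _ _ P _ _ _ (c * C)) => //.
- by apply: (mU (sp_time phi k)); exact/tau_le/ltnW.
- move=> A cA; apply: (increment_mean0 hW hFT) => //.
  + exact: le_trans (tau_ge _ (ltnW (ltn_ord k))).
  + exact: tauS.
  + exact: tau_le.
- by apply: measurable_wrtM; [exact: mXs|exact: mcoef].
- move=> w; rewrite normrM ler_pM//.
Qed.

(** Mean zero passes from simple processes to the limit: convergence in mean square implies convergence
    in mean, because |y| <= e + y^2 / e for every e > 0. *)
Lemma ito_integral_mean0 (R : realType) disp (Omega : measurableType disp)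
    (P : probability Omega R) (T : R) (W : R -> Omega -> R)
    (hW : standard_brownian_motion P T W)
    (hFT : @measurable disp Omega = completed_filtration P W T) (t : R)
    (f : R -> Omega -> R) (N : Omega -> R) :
  0 <= t -> t <= T -> ito_integral P (completed_filtration P W) W t T f N ->
  P.-integrable setT (EFin \o N) /\
  forall (X : Omega -> R) (c : R),
    measurable_wrt (completed_filtration P W t) X -> (forall w, `|X w| <= c) ->
    \int[P]_w (X w * N w) = 0.
Proof.
move=> t0 tT [mN [phi [phion _ cvgN]]].
have sp m (X : Omega -> R) (c : R) :=
  @sp_integral_mean0 R disp Omega P T W hW hFT t (phi m) X c t0 (phion m).
have isp m : P.-integrable setT (EFin \o sp_integral W (phi m)).
  apply: (sp m (fun=> 0) 0 _ _).1; first exact: measurable_wrt_cst.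
  by move=> w; rewrite normr0.
have msp m : measurable_fun setT (sp_integral W (phi m)).
  by apply/measurable_EFinP; exact: measurable_int (isp m).
pose Y m w := N w - sp_integral W (phi m) w.
have mY m : measurable_fun setT (Y m) by exact: measurable_funB.
have mY2 m : measurable_fun setT (fun w => ((Y m w) ^+ 2)%:E).
  by apply/measurable_EFinP; exact: measurable_funX.
have small e : 0 < e -> exists m, (\int[P]_w ((Y m w) ^+ 2)%:E < e%:E)%E.
  move=> e0.
  have : \forall m \near \oo, (\int[P]_w ((Y m w) ^+ 2)%:E < e%:E)%E.
    apply: (cvgN [set x | (x < e%:E)%E]); apply: open_nbhs_nbhs.
    by split; [exact: open_ereal_lt_ereal|rewrite /= lte_fin].
  by move=> [m _ H]; exists m; exact: (H m (leqnn m)).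
have L1 e m : 0 < e -> (\int[P]_w ((Y m w) ^+ 2)%:E < (e ^+ 2)%:E)%E ->
    (\int[P]_w `|Y m w|%:E <= (e + e)%:E)%E.
  move=> e0 Ym.
  have pt w : `|Y m w| <= e + e^-1 * (Y m w) ^+ 2.
    have [Ye|eY] := leP `|Y m w| e.
      by apply: le_trans Ye _; rewrite lerDl mulr_ge0 ?sqr_ge0// invr_ge0 ltW.
    rewrite -real_normK ?num_real// -[leLHS]add0r lerD ?(ltW e0)//.
    by rewrite mulrC ler_pdivlMr// expr2 ler_wpM2l// ltW.
  apply: (@le_trans _ _ (\int[P]_w (e%:E + e^-1%:E * ((Y m w) ^+ 2)%:E))%E).
    apply: ge0_le_integral => //.
    - by apply/measurable_EFinP; exact: measurableT_comp.
    - apply: emeasurable_funD => //; exact: emeasurable_funM.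
    - by move=> w _; rewrite -EFinM -EFinD lee_fin.
  rewrite ge0_integralD//; last 3 first.
  - by move=> w _; rewrite lee_fin ltW.
  - by move=> w _; rewrite -EFinM lee_fin mulr_ge0 ?sqr_ge0// invr_ge0 ltW.
  - exact: emeasurable_funM.
  rewrite integral_cst//= probability_setT mule1 ge0_integralZl//; last 2 first.
  - by move=> w _; rewrite lee_fin sqr_ge0.
  - by rewrite lee_fin invr_ge0 ltW.
  rewrite EFinD leeD2l//.
  apply: (@le_trans _ _ (e^-1%:E * (e ^+ 2)%:E)%E).
    by apply: lee_wpmul2l; [rewrite lee_fin invr_ge0 ltW|exact: ltW].
  by rewrite -EFinM lee_fin expr2 mulKf// gt_eqF.
have iY m e : 0 < e -> (\int[P]_w ((Y m w) ^+ 2)%:E < (e ^+ 2)%:E)%E ->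
    P.-integrable setT (EFin \o Y m).
  move=> e0 Ym; apply/integrableP; split; first exact/measurable_EFinP.
  exact: le_lt_trans (L1 e m e0 Ym) (ltry _).
have iN : P.-integrable setT (EFin \o N).
  have [m Ym] := small (1 ^+ 2) (exprn_gt0 2 ltr01).
  have -> : N = (fun w => Y m w - (- sp_integral W (phi m) w)).
    by apply/funext => w; rewrite /Y opprK subrK.
  apply: integrable_sub; first exact: (iY m 1).
  have -> : EFin \o (fun w => - sp_integral W (phi m) w) =
      (-%E \o (EFin \o sp_integral W (phi m))) by [].
  exact: integrableN.
split=> // X c mX Xc.
have mXT : measurable_fun setT X.
  move=> _ B mB; rewrite setTI hFT.
  by apply: (@completed_filtration_le _ _ _ _ _ t T tT); exact: mX.
apply/eqP; rewrite -normr_le0; apply/ler_addgt0Pl => e e0; rewrite addr0.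
(* so that (|c| + 1) (g + g) = e *)
pose g := e / (2 * (`|c| + 1)).
have c1 : 0 < `|c| + 1 by rewrite ltr_wpDl.
have g0 : 0 < g by rewrite divr_gt0// mulr_gt0.
have [m Ym] := small (g ^+ 2) (exprn_gt0 _ g0).
have iYm := iY m g g0 Ym.
have iXY := integrable_boundedM mXT Xc iYm.
have iXN := integrable_boundedM mXT Xc iN.
have iXS := integrable_boundedM mXT Xc (isp m).
rewrite -[X in `|X|]subr0 -(sp m X c mX Xc).2 -RintegralB//.
have -> : \int[P]_x (X x * N x - X x * sp_integral W (phi m) x) =
    \int[P]_x (X x * Y m x).
  by apply: eq_Rintegral => w _; rewrite /Y mulrBr.
apply: le_trans (le_normr_Rintegral _ iXY) _ => //.
apply: (@le_trans _ _ (\int[P]_x (`|c| * `|Y m x|))).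
  apply: le_Rintegral => //.
  - exact: integrable_norm.
  - by apply: integrable_scale => //; exact: integrable_norm.
  - move=> w _; rewrite normrM ler_wpM2r//.
    exact: le_trans (Xc w) (ler_norm _).
rewrite RintegralZl//; last exact: integrable_norm.
have YL : \int[P]_x `|Y m x| <= g + g.
  have := L1 g m g0 Ym; rewrite /Rintegral => H.
  rewrite -lee_fin fineK//; apply: integrable_fin_num => //.
  exact: integrable_norm.
apply: (@le_trans _ _ ((`|c| + 1) * (g + g))).
  by rewrite ler_pM// ?lerDl// Rintegral_ge0.
by rewrite /g le_eqVlt; apply/orP; left; apply/eqP; field; rewrite gt_eqF.
Qed.

(** * Almost sure nonnegativity at a fixed time and vector *)

Lemma qform_mean0 (R : realType) disp (Omega : measurableType disp)
    (P : probability Omega R) (U : set (set Omega)) (d : nat)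
    (N : Omega -> 'M[R]_d) (x : Omega -> 'cV[R]_d) (X : R) :
  (forall A, <<s U >> A -> measurable A) ->
  (forall i j, P.-integrable setT (EFin \o (fun w => N w i j))) ->
  (forall i j (Y : Omega -> R) c, measurable_wrt <<s U >> Y ->
    (forall w, `|Y w| <= c) -> \int[P]_w (Y w * N w i j) = 0) ->
  (forall i, measurable_wrt <<s U >> (fun w => x w i ord0)) ->
  (forall w, `|x w| <= X) ->
  P.-integrable setT (EFin \o (fun w => qform (N w) (x w))) /\
  \int[P]_w qform (N w) (x w) = 0.
Proof.
move=> mU iN N0 mx xX.
have mxx i j : measurable_wrt <<s U >> (fun w => x w i ord0 * x w j ord0).
  exact: measurable_wrtM.
have bxx i j w : `|x w i ord0 * x w j ord0| <= X * X.
  by rewrite normrM ler_pM// (le_trans (mx_entry_le_norm _ _ _) (xX w)).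
have ixN i j : P.-integrable setT
    (EFin \o (fun w => x w i ord0 * x w j ord0 * N w i j)).
  apply: (integrable_boundedM _ (bxx i j)) => //.
  by move=> _ B mB; rewrite setTI; apply: mU; exact: mxx.
have E w : qform (N w) (x w) =
    \sum_i \sum_j x w i ord0 * x w j ord0 * N w i j.
  by rewrite qformE; apply: eq_bigr => i _; apply: eq_bigr => j _; rewrite mulrAC.
have isum i : P.-integrable setT
    (EFin \o (fun w => \sum_j x w i ord0 * x w j ord0 * N w i j)).
  exact: integrable_sum_fin.
split.
  rewrite (_ : (fun w => _) =
    fun w => \sum_i \sum_j x w i ord0 * x w j ord0 * N w i j); last exact/funext.
  exact: integrable_sum_fin.
under eq_Rintegral do rewrite E.
rewrite Rintegral_sum// big1// => i _; rewrite Rintegral_sum// big1// => j _.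
exact: (N0 _ _ _ (X * X)).
Qed.

Lemma measurable_qform (R : realType) disp (Omega : measurableType disp)
    (d : nat) (D : Omega -> 'M[R]_d) (x : Omega -> 'cV[R]_d) :
  (forall i j, measurable_fun setT (fun w => D w i j)) ->
  (forall i, measurable_fun setT (fun w => x w i ord0)) ->
  measurable_fun setT (fun w => qform (D w) (x w)).
Proof.
move=> mD mx.
rewrite (_ : (fun w => _) = fun w => \sum_i \sum_j x w i ord0 * D w i j * x w j ord0).
  apply: measurable_sum => i; apply: measurable_sum => j.
  by apply: measurable_funM => //; exact: measurable_funM.
by apply/funext => w; rewrite qformE.
Qed.

(** The mean of |q| is the opposite of the mean of q. *)
Lemma ae_eq0_of_le0 (R : realType) disp (Omega : measurableType disp)
    (P : probability Omega R) (q : Omega -> R) :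
  P.-integrable setT (EFin \o q) -> (forall w, q w <= 0) ->
  0 <= \int[P]_w q w -> {ae P, forall w, q w = 0}.
Proof.
move=> iq q0 Iq.
have mq := measurable_int _ iq.
have : (\int[P]_w `|(EFin \o q) w| = 0)%E.
  transitivity (\int[P]_w (- (q w)%:E))%E.
    by apply: eq_integral => w _; rewrite /= ler0_norm.
  rewrite integralN /=; last first.
    exact: integrable_add_def.
  have fin := integrable_fin_num measurableT iq.
  rewrite -(fineK fin) -EFinN; congr EFin; apply/eqP.
  rewrite oppr_eq0 eq_le Iq andbT.
  rewrite -lee_fin fineK//.
  by apply: (@le_trans _ _ (\int[P]_w (cst 0) w)%E);
    [apply: le_integral => //; [exact: integrable0|move=> w _; rewrite lee_fin] |
     rewrite integral0].
move=> /(ae_eq_integral_abs P measurableT mq); apply: filterS => w /(_ I) /= [].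
by [].
Qed.

(** Dominated convergence for the negative parts min (Z n) 0, which lie between
    - C and 0 and tend to 0. *)
Lemma mean_ge0_of_approx (R : realType) disp (Omega : measurableType disp)
    (P : probability Omega R) (q : R) (Z : nat -> Omega -> R) (C : R) :
  (forall n, P.-integrable setT (EFin \o Z n)) ->
  (forall n, \int[P]_w Z n w = q) ->
  {ae P, forall w, (forall n, - C <= Z n w) /\
    forall e, 0 < e -> \forall n \near \oo, - e <= Z n w} ->
  0 <= q.
Proof.
move=> iZ Zq Zlow.
pose Y n w := Num.min (Z n w) 0.
have mZ n : measurable_fun setT (Z n) by apply/measurable_EFinP; exact: measurable_int (iZ n).
have mY n : measurable_fun setT (Y n) by exact: measurable_minr.
have Y0 n w : Y n w <= 0 by rewrite ge_min lexx orbT.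
have cvgY : (\int[P]_w (Y n w)%:E)%E @[n --> \oo] --> 0%E.
  have [||||| _ _] := @dominated_convergence _ _ _ P setT measurableT
    (fun n w => (Y n w)%:E) (cst 0%E) (cst `|C|%:E) => //; last by rewrite integral0.
  - by move=> n; exact/measurable_EFinP.
  - apply: filterS Zlow => w [_ Zw] _ /=.
    apply: cvg_EFin; first by near=> n.
    apply/cvgrPdist_le => e e0 /=; apply: filterS (Zw e e0) => n Zn.
    by rewrite sub0r normrN ler0_norm// lerNl le_min Zn oppr_le0 ltW.
  - exact: finite_measure_integrable_cst.
  - apply: filterS Zlow => w [Zw _] n _ /=.
    rewrite lee_fin ler0_norm// lerNl le_min oppr_le0 normr_ge0 andbT.
    by apply: le_trans (Zw n); rewrite lerN2 ler_norm.
rewrite -lee_fin; apply: (cvge_le _ cvgY); near=> n.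
have ifin := integrable_fin_num measurableT (iZ n).
rewrite -(Zq n) /Rintegral fineK//.
have iY : P.-integrable setT (EFin \o Y n).
  apply: le_integrable (iZ n) => //; first exact/measurable_EFinP.
  move=> w _; rewrite /= lee_fin /Y /Num.min.
  by case: ifP => _ //; rewrite normr0.
apply: (le_integral measurableT iY (iZ n)) => w _; rewrite /= lee_fin.
by rewrite ge_min lexx.
Unshelve. all: by end_near. Qed.

(** The probabilistic core: A, D, Q are the coefficients of the linear equation
    solved by D, and N is its noise.  The Euler scheme starts from v on the event
    where the quadratic form is negative. *)
Lemma quadratic_form_ge0 (R : realType) disp (Omega : measurableType disp)
    (P : probability Omega R) (T : R) (W : R -> Omega -> R)
    (hFT : @measurable disp Omega = completed_filtration P W T)
    (d : nat) (D A Q N : R -> Omega -> 'M[R]_d) (C t0 : R) (v : 'cV[R]_d) :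
  0 <= t0 <= T -> 0 <= C ->
  (forall t i j, 0 <= t <= T ->
    measurable_wrt (completed_filtration P W t) (fun w => A t w i j)) ->
  (forall t i j, 0 <= t <= T ->
    measurable_wrt (completed_filtration P W t) (fun w => D t w i j)) ->
  (forall w, [/\ {within `[0, T], continuous (fun t => A t w)},
     {within `[0, T], continuous (fun t => D t w)} &
     {within `[0, T], continuous (fun t => Q t w)}]) ->
  {ae P, forall w, nonneg_definite (D T w) /\ forall t, 0 <= t <= T ->
    [/\ (D t w)^T = D t w, nonneg_definite (Q t w), `|A t w| <= C &
        `|D t w| <= C]} ->
  (forall t i j, 0 <= t <= T -> P.-integrable setT (EFin \o (fun w => N t w i j)) /\
    forall (Y : Omega -> R) c, measurable_wrt (completed_filtration P W t) Y ->
    (forall w, `|Y w| <= c) -> \int[P]_w (Y w * N t w i j) = 0) ->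
  (forall s t, 0 <= s -> s <= t -> t <= T -> {ae P, forall w,
    D s w - D t w - mx_integral (drift (A^~ w) (D^~ w) (Q^~ w)) s t =
    N t w - N s w}) ->
  {ae P, forall w, 0 <= qform (D t0 w) v}.
Proof.
move=> /andP[t00 t0T] C0 mA mD cont good hN hD.
have t0T' : 0 <= t0 <= T by rewrite t00.
have hT : 0 <= T by exact: le_trans t0T.
have Fmeas t : t <= T -> forall B, completed_filtration P W t B -> measurable B.
  by move=> tT B; rewrite hFT; exact: completed_filtration_le.
have [B [mB PB0 goodB]] := good.
have goodw w : ~ B w -> nonneg_definite (D T w) /\ forall t, 0 <= t <= T ->
    [/\ (D t w)^T = D t w, nonneg_definite (Q t w), `|A t w| <= C &
        `|D t w| <= C].
  by move=> Bw; apply: contrapT => H; apply: Bw; apply: goodB.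
(* switching A off outside the good event makes the scheme bounded everywhere;
   the filtration is complete, so this keeps it adapted *)
pose g w : R := \1_(~` B) w.
have FB t : completed_filtration P W t (~` B).
  have [_ FC _] : sigma_algebra setT (completed_filtration P W t).
    exact: smallest_sigma_algebra.
  rewrite -setTD; apply: FC; apply: negligible_completed; exists B; split => //.
pose E0 := [set w | qform (D t0 w) v < 0].
pose x0 w : 'cV[R]_d := \1_E0 w *: v.
pose h n : R := (T - t0) / n.+1%:R.
pose t n k : R := t0 + k%:R * h n.
pose a n w k := g w *: A (t n k) w.
pose x n k w := euler (h n) (a n w) (x0 w) k.
have h0 n : 0 <= h n by rewrite divr_ge0// subr_ge0.
have tn n : t n n.+1 = T.
  by rewrite /t /h mulrC divfK ?pnatr_eq0// addrC subrK.
have tS n k : t n k <= t n k.+1 by rewrite lerD2l ler_wpM2r// ler_nat.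
have tT n k : (k <= n.+1)%N -> 0 <= t n k <= T.
  move=> kn; apply/andP; split; first by rewrite addr_ge0// mulr_ge0.
  by rewrite -[leRHS](tn n) /t lerD2l ler_wpM2r// ler_nat.
have mq0 : measurable_wrt (completed_filtration P W t0) (fun w => qform (D t0 w) v).
  rewrite (_ : (fun w => _) =
      fun w => \sum_i \sum_j v i ord0 * D t0 w i j * v j ord0).
    do 2 (apply: measurable_wrt_sum => ?).
    apply: measurable_wrtM; last exact: measurable_wrt_cst.
    by apply: measurable_wrtM; [exact: measurable_wrt_cst|exact: mD].
  by apply/funext => w; rewrite qformE.
have FE0 : completed_filtration P W t0 E0.
  rewrite (_ : E0 = (fun w => qform (D t0 w) v) @^-1` `]-oo, 0[).
    by apply: mq0; exact: measurable_itv.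
  by apply/seteqP; split => w /=; rewrite in_itv.
have mx n k : (k <= n.+1)%N -> forall i,
    measurable_wrt (completed_filtration P W (t n k)) (fun w => x n k w i ord0).
  elim: k => [_ i|k IH kn i].
    rewrite /x /= /t mul0r addr0 /x0.
    rewrite (_ : (fun w => _) = fun w => \1_E0 w * v i ord0).
      apply: measurable_wrtM; last exact: measurable_wrt_cst.
      exact: measurable_wrt_indic.
    by apply/funext => w; rewrite mxE.
  have up (Y : Omega -> R) : measurable_wrt (completed_filtration P W (t n k)) Y ->
      measurable_wrt (completed_filtration P W (t n k.+1)) Y.
    by move=> mY S mS; apply: (completed_filtration_le (tS n k)); exact: mY.
  rewrite (_ : (fun w => _) = fun w => x n k w i ord0 +
     h n * \sum_j (g w * A (t n k) w i j) * x n k w j ord0).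
    apply: up; apply: measurable_wrtD; first exact: IH (ltnW kn) i.
    apply: measurable_wrtM; first exact: measurable_wrt_cst.
    apply: measurable_wrt_sum => j; apply: measurable_wrtM; last exact: IH (ltnW kn) j.
    apply: measurable_wrtM.
      by apply: measurable_wrt_indic; exact: FB.
    by apply: mA; exact: tT (ltnW kn).
  apply/funext => w; rewrite /x /= !mxE; congr (_ + _ * _).
  by apply: eq_bigr => j _; rewrite !mxE.
pose X := expR (d%:R * C * (T - t0)) * `|v|.
have x0v w : `|x0 w| <= `|v|.
  rewrite /x0 normrZ indicE; case: (_ \in _); rewrite ?normr1 ?mul1r//.
  by rewrite normr0 mul0r.
have aC n w k : (k <= n.+1)%N -> `|a n w k| <= C.
  move=> kn; rewrite /a normrZ /g indicE.
  have [/set_mem Bw|_] := boolP (w \in ~` B).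
  have := (goodw w Bw).2 _ (tT n k kn) => -[_ _ AC _].
    by rewrite normr1 mul1r.
  by rewrite normr0 mul0r.
have xX n k w : (k <= n.+1)%N -> `|x n k w| <= X.
  move=> kn; apply: le_trans (norm_euler _ _ (C := C) _ _) _ => //.
    by move=> l lk; apply: aC; exact: leq_trans (ltnW lk) kn.
  rewrite ler_pM ?expR_ge0// ler_expR ler_wpM2l ?mulr_ge0//.
  have := tn n; rewrite /t => /(congr1 (fun z => z - t0)).
  by rewrite addrAC subrr add0r => <-; rewrite ler_wpM2r// ler_nat.
pose q0 w := qform (D t0 w) (x0 w).
have q0le w : q0 w <= 0.
  rewrite /q0 /x0 qform_scale indicE; case: (boolP (w \in E0)) => [/set_mem|_].
    by rewrite /E0 /= expr1n mul1r => /ltW.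
  by rewrite expr0n mul0r.
have mq : measurable_fun setT q0.
  apply: measurable_qform => [i j|i] _ S mS; rewrite setTI.
    by apply: (Fmeas t0 t0T); exact: mD.
  have := mx 0%N 0%N isT i; rewrite /x /= /t mul0r addr0 => mx0.
  by apply: (Fmeas t0 t0T); exact: mx0.
have iq : P.-integrable setT (EFin \o q0).
  apply/integrableP; split; first exact/measurable_EFinP.
  apply: (@le_lt_trans _ _ (\int[P]_w (cst (d%:R ^+ 2 * C * `|v| ^+ 2)%:E) w)%E).
    apply: ae_ge0_le_integral => //.
    - by apply/measurable_EFinP; exact: measurableT_comp.
    - by move=> w _; rewrite lee_fin !mulr_ge0// exprn_ge0.
    apply: filterS good => w [_ Hw] _ /=; rewrite lee_fin.
    have [_ _ _ DC] := Hw t0 t0T'.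
    rewrite /q0 (le_trans (norm_qform _ _))//.
    rewrite ler_pM ?mulr_ge0 ?exprn_ge0// ?ler_wpM2l ?exprn_ge0//.
    by rewrite ler_sqr ?nnegrE.
  by rewrite integral_cst//= probability_setT mule1 ltry.
have iNx n (k : 'I_n.+1) : P.-integrable setT (EFin \o
     (fun w => qform (N (t n k.+1) w - N (t n k) w) (x n k w))) /\
    \int[P]_w qform (N (t n k.+1) w - N (t n k) w) (x n k w) = 0.
  have kn := ltn_ord k.
  have N1 := hN _ _ _ (tT n k.+1 kn).
  have N0 := hN _ _ _ (tT n k (ltnW kn)).
  have tkT : t n k <= T by case/andP: (tT n k (ltnW kn)).
  have mxk := mx n k (ltnW kn).
  have xXk w := xX n k w (ltnW kn).
  have i1 := @qform_mean0 R disp Omega P _ d (N (t n k.+1)) (x n k) X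
    (Fmeas _ tkT) (fun i j => (N1 i j).1) _ mxk xXk.
  have i0 := @qform_mean0 R disp Omega P _ d (N (t n k)) (x n k) X
    (Fmeas _ tkT) (fun i j => (N0 i j).1) (fun i j => (N0 i j).2) mxk xXk.
  have {}i1 := i1 (fun i j Y c mY => (N1 i j).2 Y c
    (fun S mS => completed_filtration_le (tS n k) (mY S mS))).
  split.
    rewrite (_ : (fun w => _) = fun w =>
        qform (N (t n k.+1) w) (x n k w) - qform (N (t n k) w) (x n k w)).
      by apply: integrable_sub; [exact: i1.1|exact: i0.1].
    by apply/funext => w; rewrite qformB.
  under eq_Rintegral do rewrite qformB.
  by rewrite RintegralB ?i1.2 ?i0.2 ?subrr//; [exact: i1.1|exact: i0.1].
pose Z n w := q0 w -
  \sum_(k < n.+1) qform (N (t n k.+1) w - N (t n k) w) (x n k w).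
have isum n : P.-integrable setT (EFin \o (fun w =>
    \sum_(k < n.+1) qform (N (t n k.+1) w - N (t n k) w) (x n k w))).
  by apply: integrable_sum_fin => // k; exact: (iNx n k).1.
have iZ n : P.-integrable setT (EFin \o Z n) by exact: integrable_sub.
have ZE n : \int[P]_w Z n w = \int[P]_w q0 w.
  rewrite RintegralB// [X in _ - X](_ : _ = 0) ?subr0//.
  rewrite Rintegral_sum//; last by move=> k; exact: (iNx n k).1.
  by rewrite big1// => k _; exact: (iNx n k).2.
have hDn : {ae P, forall w, forall n (k : nat), (k < n.+1)%N ->
    D (t n k) w - D (t n k.+1) w -
    mx_integral (drift (A^~ w) (D^~ w) (Q^~ w)) (t n k) (t n k.+1) =
    N (t n k.+1) w - N (t n k) w}.
  apply: ae_foralln => n; apply: ae_foralln => k.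
  have [kn|kn] := boolP (k < n.+1)%N; last by apply: aeW => w.
  have /andP[tk0 _] := tT n k (ltnW kn); have /andP[_ tkT] := tT n k.+1 kn.
  by apply: filterS (hD _ _ tk0 (tS n k) tkT) => w.
(* q0 is the minimum of 0 and v^T D(t0) v; Z has the same mean *)
have q0ae : {ae P, forall w, q0 w = 0}.
  apply: ae_eq0_of_le0 => //.
  pose kappa := (T - t0) * (4 * d%:R ^+ 3 * X ^+ 2 * C * (C + C) +
                 (T - t0) * (d%:R ^+ 2 * C * (d%:R * C * X) ^+ 2)).
  apply: (@mean_ge0_of_approx _ _ _ P _ Z kappa iZ ZE).
  have nB : {ae P, forall w, ~ B w} by exists B; split => // w /contrapT.
  apply: filterS2 nB hDn => w Bw DN.
  have [DT Hw] := goodw w Bw.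
  have [cA cD cQ] := cont w.
  have sub : `[t0, T] `<=` `[0, T] by apply: subset_itv; rewrite bnd_simp.
  have ZwE n : Z n w = defect (h n) ((D^~ w) \o t n) (a n w)
     (fun k => mx_integral (drift (A^~ w) (D^~ w) (Q^~ w)) (t n k) (t n k.+1))
     (x0 w) n.+1.
    have tn0 : t n 0%N = t0 by rewrite /t mul0r addr0.
    rewrite /Z /defect /= tn0; congr (_ - _).
    by apply: eq_bigr => k _; rewrite DN.
  have := @defect_bounds R d t0 T C `|v| (A^~ w) (D^~ w) (Q^~ w)
    (fun n => a n w) (x0 w) t0T C0 (x0v w).
  rewrite -/X -/kappa; case.
  - by move=> r /andP[r0 rT]; apply: Hw; rewrite rT (le_trans t00).
  - exact: DT.
  - exact: continuous_subspaceW cA.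
  - exact: continuous_subspaceW cD.
  - exact: continuous_subspaceW cQ.
  - by move=> n k kn; rewrite /a /g indicE mem_set// scale1r.
  move=> Zl Ze; split=> [n|e e0]; first by rewrite ZwE; exact: Zl.
  by apply: filterS (Ze e e0) => n; rewrite ZwE.
apply: filterS q0ae => w; rewrite /q0 /x0 qform_scale indicE.
case: (boolP (w \in E0)) => [/set_mem E0w|/negP E0w _].
  by rewrite expr1n mul1r => ->.
by rewrite leNgt; apply/negP => H; apply: E0w; exact: mem_set.
Qed.

(** * Paths, bounds and a countable dense family *)

Lemma Linf_continuous_bounded (R : realType) disp (Omega : measurableType disp)
    (P : probability Omega R) (T : R) (F : R -> set (set Omega)) (d : nat)
    (H : set 'M[R]_d) (f : R -> Omega -> 'M[R]_d) :
  Linf_continuous P T F H f ->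
  exists2 C : R, 0 <= C &
    {ae P, forall w, forall t, 0 <= t <= T -> `|f t w| <= C}.
Proof.
case=> _ _ _ fin; set g := fun w => _ in fin.
have [C C0 gC] : exists2 C : R, 0 <= C & (ess_sup P g <= C%:E)%E.
  move: fin; case: (ess_sup P g) => [r| |] //= _.
    by exists `|r| => //; rewrite lee_fin ler_norm.
  by exists 0 => //; rewrite leNye.
exists C => //; apply: filterS (ess_sup_ge P g) => w gw t tT.
rewrite -lee_fin; apply: le_trans gC; apply: le_trans gw.
by apply: ereal_sup_ubound; exists t => //=; rewrite in_itv.
Qed.

Lemma mx_integral_split (R : realType) (d : nat) (b : R -> 'M[R]_d) (s t u : R) :
  s <= t -> t <= u -> {within `[s, u], continuous b} ->
  mx_integral b s u = mx_integral b s t + mx_integral b t u.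
Proof.
move=> st tu cb; apply/matrixP => i j; rewrite !mxE.
have ib := integrable_continuous_entry i j cb.
have := @Rintegral_itvB R (fun r => b r i j) (BLeft s) (BRight u) t ib.
rewrite !bnd_simp => /(_ st tu) /eqP; rewrite subr_eq => /eqP ->.
rewrite addrC; congr (_ + _); apply: Rintegral_itv_obnd_cbnd.
apply: integrableS ib => //; apply: subset_itvr => //.
Qed.

Lemma mx_integralB (R : realType) (d : nat) (b c : R -> 'M[R]_d) (s t : R) :
  {within `[s, t], continuous b} -> {within `[s, t], continuous c} ->
  mx_integral (fun r => b r - c r) s t = mx_integral b s t - mx_integral c s t.
Proof.
move=> cb cc; apply/matrixP => i j; rewrite !mxE.
rewrite -RintegralB//; try exact: integrable_continuous_entry.
by apply: eq_Rintegral => r _; rewrite !mxE.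
Qed.

(** Test against the indicators of the events N < 0 and N > 0. *)
Lemma mean0_ae0 (R : realType) disp (Omega : measurableType disp)
    (P : probability Omega R) (N : Omega -> R) :
  P.-integrable setT (EFin \o N) ->
  (forall (Y : Omega -> R) c, measurable_fun setT Y ->
    (forall w, `|Y w| <= c) -> \int[P]_w (Y w * N w) = 0) ->
  {ae P, forall w, N w = 0}.
Proof.
move=> iN N0.
have mN : measurable_fun setT N by apply/measurable_EFinP; exact: measurable_int iN.
have half (e : R) : `|e| <= 1 -> {ae P, forall w, e * N w < 0 -> False}.
  move=> e1; pose E := [set w | e * N w < 0].
  have mE : measurable E.
    rewrite (_ : E = (fun w => e * N w) @^-1` `]-oo, 0[).
      have me : measurable_fun setT (fun w => e * N w) by exact: measurable_funM.
      by rewrite -[_ @^-1` _]setTI; apply: me => //; exact: measurable_itv.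
    by apply/seteqP; split => w /=; rewrite in_itv.
  pose Y w : R := e * \1_E w.
  have mY : measurable_fun setT Y by apply: measurable_funM => //; exact: measurable_indic.
  have Y1 w : `|Y w| <= 1.
    rewrite /Y normrM indicE; case: (_ \in _); last by rewrite normr0 mulr0.
    by rewrite normr1 mulr1.
  have := @ae_eq0_of_le0 _ _ _ P (fun w => Y w * N w) (integrable_boundedM mY Y1 iN).
  move=> /(_ _ _) H; apply: filterS (H _ _).
  - move=> w /= YN eN; move: YN; rewrite /Y indicE mem_set// mulr1 => E0.
    by move: eN; rewrite E0 ltxx.
  - move=> w; rewrite /Y indicE; have [/set_mem|_] := boolP (w \in E).
      by rewrite /E /= mulr1 => /ltW.
    by rewrite mulr0 mul0r.
  - by rewrite (N0 Y 1).
have h1 := half 1; have hN1 := half (-1).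
apply: filterS2 (h1 _) (hN1 _); rewrite ?normrN1 ?normr1// => w /=.
rewrite mul1r mulN1r oppr_lt0 => n1 n2.
by apply/eqP; rewrite eq_le !leNgt; apply/andP; split; apply/negP.
Qed.

Lemma cvg_floor_div (R : realType) (x : R) :
  ((Num.floor (n.+1%:R * x))%:~R / n.+1%:R : R) @[n --> \oo] --> x.
Proof.
apply/cvgrPdist_le => e e0.
have /cvgr0Pnorm_le/(_ e e0) := @cvg_harmonic R.
apply: filterS => n; apply: le_trans.
have n0 : 0 < n.+1%:R :> R by rewrite ltr0n.
have /andP[f1 f2] := floor_itv (n.+1%:R * x).
rewrite ger0_norm; last by rewrite subr_ge0 ler_pdivrMr// [x * _]mulrC.
rewrite /harmonic /= ger0_norm ?invr_ge0// lerBlDr -[X in _ <= X + _]mul1r -mulrDl.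
by rewrite ler_pdivlMr// [x * _]mulrC ltW// addrC; move: f2; rewrite intrD.
Qed.

(** Integral vectors and rational times are enough: by homogeneity the vector z may
    be divided by n, and the points floor (n x) / n tend to x. *)
Lemma qform_ge0_dense (R : realType) (d : nat) (T : R) (D : R -> 'M[R]_d) :
  {within `[0, T], continuous D} ->
  (forall (z : 'cV[int]_d) (p : int) (q : nat),
    0 <= (p%:~R / q.+1%:R : R) <= T ->
    0 <= qform (D (p%:~R / q.+1%:R)) (map_mx (intmul 1) z)) ->
  forall t, 0 <= t <= T -> nonneg_definite (D t).
Proof.
move=> /subspace_continuousP cD Dz t tT x.
pose s n : R := (Num.floor (n.+1%:R * t))%:~R / n.+1%:R.
pose z n : 'cV[int]_d := \col_i Num.floor (n.+1%:R * x i ord0).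
pose y n : 'cV[R]_d := \col_i ((z n i ord0)%:~R / n.+1%:R).
have sT n : 0 <= s n <= T.
  have n0 : 0 < n.+1%:R :> R by rewrite ltr0n.
  case/andP: tT => t0 tT; rewrite divr_ge0//=; last first.
    by rewrite ler0z floor_ge0 mulr_ge0.
  apply: le_trans tT; rewrite ler_pdivrMr// [t * _]mulrC.
  exact: floor_le.
have cs : D (s n) @[n --> \oo] --> D t.
  have /(_ _) := cD t; rewrite /= in_itv /= => /(_ tT) cDt.
  apply: cvg_trans cDt => A /= hA.
  have {}hA : nbhs (t : R) [set y | `[0, T]%classic y -> A (D y)] by exact: hA.
  have := @cvg_floor_div R t _ hA; rewrite /nbhs /=; apply: filterS => n.
  by apply; rewrite /= in_itv; exact: sT.
have cy : y n @[n --> \oo] --> x.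
  apply: cvg_mx_entries => i j; rewrite (ord1 j).
  under eq_fun do rewrite !mxE.
  exact: cvg_floor_div.
have cyT : (y n)^T @[n --> \oo] --> x^T by exact: cvg_trmx.
have cq : qform (D (s n)) (y n) @[n --> \oo] --> (x^T *m D t *m x) ord0 ord0.
  apply: (@cvg_mx_entry R _ _ _ 1 1 (fun n => (y n)^T *m D (s n) *m y n)).
  by apply: cvg_mulmx => //; exact: cvg_mulmx.
have q0 n : 0 <= qform (D (s n)) (y n).
  have -> : y n = n.+1%:R^-1 *: map_mx intr (z n).
    by apply/matrixP => i j; rewrite (ord1 j) !mxE mulrC.
  by rewrite qform_scale mulr_ge0 ?sqr_ge0//; apply: Dz; exact: sT.
rewrite leNgt; apply/negP => q1.
have [n _ /(_ n (leqnn n))] := cvgr_lt _ cq 0 q1.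
by rewrite ltNge q0.
Qed.

(** * Comparison of two Riccati equations *)

Definition riccati_rhs (R : realType) (d : nat) (G H I K : 'M[R]_d) : 'M[R]_d :=
  K *m H *m K - G^T *m K - K *m G - I.

(** Writing K1 and K2 as the mean of the two plus or minus D/2 makes the quadratic
    term linear: K2 H2 K2 - K1 H2 K1 = D H2 Kbar + Kbar H2 D. *)
Lemma riccati_rhs_difference (R : realType) (d : nat)
    (G H1 I1 H2 I2 K1 K2 : 'M[R]_d)
    (A := G - H2 *m (2^-1 *: (K1 + K2)))
    (D := K2 - K1) (Q := K1 *m (H1 - H2) *m K1 + (I2 - I1)) :
  H2^T = H2 -> K1^T = K1 -> K2^T = K2 ->
  riccati_rhs G H1 I1 K1 - riccati_rhs G H2 I2 K2 = A^T *m D + D *m A + Q.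
Proof.
move=> h2 k1 k2; rewrite /riccati_rhs /A /D /Q.
have -> : (G - H2 *m (2^-1 *: (K1 + K2)))^T = G^T - 2^-1 *: ((K1 + K2) *m H2).
  rewrite linearB /= -scalemxAr linearZ /= trmx_mul h2 linearD /= k1 k2.
  by [].
rewrite !(mulmxBl, mulmxBr, mulmxDl, mulmxDr, =^~ scalemxAl, =^~ scalemxAr, mulmxA).
move: (K1 *m H1 *m K1) (K2 *m H2 *m K2) (K1 *m H2 *m K1) (K1 *m H2 *m K2)
  (K2 *m H2 *m K1) (G^T *m K1) (G^T *m K2) (K1 *m G) (K2 *m G) => *.
by apply/matrixP => i j; rewrite !mxE; field.
Qed.

(** The form in which the equation is used: N t, the stochastic integral from t to
    T, has mean zero given the past of t.  At t = T every bounded variable is a test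
    variable, so N T vanishes and K takes its terminal value. *)
Lemma riccati_noise (R : realType) disp (Omega : measurableType disp)
    (P : probability Omega R) (T : R) (W : R -> Omega -> R)
    (hW : standard_brownian_motion P T W)
    (hFT : @measurable disp Omega = completed_filtration P W T)
    (d : nat) (G H I : R -> Omega -> 'M[R]_d) (S : Omega -> 'M[R]_d)
    (K M : R -> Omega -> 'M[R]_d) (F := completed_filtration P W)
    (g := fun w t => riccati_rhs (G t w) (H t w) (I t w) (K t w)) :
  0 <= T -> (forall w, {within `[0, T], continuous (g w)}) ->
  riccati_bsde P T F W G H I S K M ->
  exists N : R -> Omega -> 'M[R]_d,
    [/\ forall t i j, 0 <= t <= T ->
          P.-integrable setT (EFin \o (fun w => N t w i j)) /\
          forall (Y : Omega -> R) c, measurable_wrt (F t) Y ->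
            (forall w, `|Y w| <= c) -> \int[P]_w (Y w * N t w i j) = 0,
        forall s t, 0 <= s -> s <= t -> t <= T -> {ae P, forall w,
          K s w - K t w + mx_integral (g w) s t = N t w - N s w} &
        {ae P, forall w, K T w = S w}].
Proof.
move=> T0 cg hE.
have /choice[N hN] : forall t, exists N : Omega -> 'M[R]_d, 0 <= t <= T ->
    (forall i j, ito_integral P F W t T (fun s w => M s w i j) (fun w => N w i j))
    /\ {ae P, forall w, K t w = S w - mx_integral (g w) t T - N w}.
  move=> t; have [tT|tT] := boolP (0 <= t <= T); last by exists (fun=> 0).
  by have [N N1 N2] := hE t tT; exists N.
have noise t i j : 0 <= t <= T ->
    P.-integrable setT (EFin \o (fun w => N t w i j)) /\
    forall (Y : Omega -> R) c, measurable_wrt (F t) Y ->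
      (forall w, `|Y w| <= c) -> \int[P]_w (Y w * N t w i j) = 0.
  move=> /[dup] /andP[t0 tT] /hN[itoN _].
  exact: (ito_integral_mean0 hW hFT t0 tT (itoN i j)).
have TT : 0 <= T <= T by rewrite T0 lexx.
exists N; split => //.
- move=> s t s0 st tT.
  have sT : 0 <= s <= T by rewrite s0 (le_trans st).
  have t0T : 0 <= t <= T by rewrite tT (le_trans s0).
  have [_ Ns] := hN s sT; have [_ Nt] := hN t t0T.
  apply: filterS2 Ns Nt => w -> ->.
  rewrite (mx_integral_split st tT); last first.
    by apply: continuous_subspaceW (cg w); apply: subset_itv; rewrite bnd_simp.
  move: (mx_integral (g w) s t) (mx_integral (g w) t T) => a b.
  by apply/matrixP => i j; rewrite !mxE; ring.
- have NT0 : {ae P, forall w, forall i j, N T w i j = 0}.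
    have : forall ij : 'I_d * 'I_d, {ae P, forall w, N T w ij.1 ij.2 = 0}.
      move=> [i j]; have [iN N0] := noise T i j TT.
      apply: mean0_ae0 iN _ => Y c mY Yc; apply: N0 Yc.
      by move=> B mB; rewrite /F -hFT -[_ @^-1` _]setTI; exact: mY.
    move=> /filter_forall; apply: filterS => w Nw i j; exact: (Nw (i, j)).
  have [_ NT] := hN T TT; apply: filterS2 NT NT0 => w -> N0.
  apply/matrixP => i j; rewrite !mxE N0 subr0.
  by rewrite set_itv1 Rintegral_set1 subr0.
Qed.

Lemma nonneg_definite_conj (R : realType) (d : nat) (H K : 'M[R]_d) :
  K^T = K -> nonneg_definite H -> nonneg_definite (K *m H *m K).
Proof.
by move=> KK H0 x; rewrite -/(qform _ _) -[X in X *m _ *m _]KK qform_conj; exact: H0.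
Qed.

Theorem theoremA1 (R : realType) (disp : measure_display)
    (Omega : measurableType disp) (P : probability Omega R)
    (T : R) (hT : 0 < T) (W : R -> Omega -> R)
    (hW : standard_brownian_motion P T W)
    (F : R -> set (set Omega)) (hF : F = completed_filtration P W)
    (hFT : @measurable disp Omega = F T)
    (d : nat)
    (G H1 I1 H2 I2 : R -> Omega -> 'M[R]_d) (S1 S2 : Omega -> 'M[R]_d)
    (hG : Linf_continuous P T F setT G)
    (hH1 : Linf_continuous P T F (@symmetric_matrices R d) H1)
    (hI1 : Linf_continuous P T F (@symmetric_matrices R d) I1)
    (hH2 : Linf_continuous P T F (@symmetric_matrices R d) H2)
    (hI2 : Linf_continuous P T F (@symmetric_matrices R d) I2)
    (hS1 : Linf_rv P T F (@symmetric_matrices R d) S1)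
    (hS2 : Linf_rv P T F (@symmetric_matrices R d) S2)
    (hS12 : {ae P, forall w, loewner_le (S1 w) (S2 w)})
    (hH0 : {ae P, forall w, forall t : R, 0 <= t <= T -> loewner_le 0 (H2 t w)})
    (hH21 : {ae P, forall w, forall t : R, 0 <= t <= T ->
              loewner_le (H2 t w) (H1 t w)})
    (hI12 : {ae P, forall w, forall t : R, 0 <= t <= T ->
              loewner_le (I1 t w) (I2 t w)})
    (K1 M1 K2 M2 : R -> Omega -> 'M[R]_d)
    (hK1 : Linf_continuous P T F (@symmetric_matrices R d) K1)
    (hM1 : L2_adapted P T F (@symmetric_matrices R d) M1)
    (hK2 : Linf_continuous P T F (@symmetric_matrices R d) K2)
    (hM2 : L2_adapted P T F (@symmetric_matrices R d) M2)
    (hE1 : riccati_bsde P T F W G H1 I1 S1 K1 M1)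
    (hE2 : riccati_bsde P T F W G H2 I2 S2 K2 M2) :
  {ae P, forall w, forall t : R, 0 <= t <= T -> loewner_le (K1 t w) (K2 t w)}.
Proof.
subst F.
have T0 : 0 <= T by exact: ltW.
pose Kbar t w := 2^-1 *: (K1 t w + K2 t w).
pose A t w := G t w - H2 t w *m Kbar t w.
pose D t w := K2 t w - K1 t w.
pose Q t w := K1 t w *m (H1 t w - H2 t w) *m K1 t w + (I2 t w - I1 t w).
pose g1 w t := riccati_rhs (G t w) (H1 t w) (I1 t w) (K1 t w).
pose g2 w t := riccati_rhs (G t w) (H2 t w) (I2 t w) (K2 t w).
have [_ mG cG _] := hG; have [_ _ cH1 _] := hH1; have [sH2 mH2 cH2 _] := hH2.
have [_ _ cI1 _] := hI1; have [_ _ cI2 _] := hI2.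
have [sK1 mK1 cK1 _] := hK1; have [sK2 mK2 cK2 _] := hK2.
have cA w : {within `[0, T], continuous (fun t => A t w)}.
  move=> t; apply: cvgB; first exact: cG.
  apply: cvg_mulmx; first exact: cH2.
  by apply: cvgZr; apply: cvgD; [exact: cK1|exact: cK2].
have cD w : {within `[0, T], continuous (fun t => D t w)}.
  by move=> t; apply: cvgB; [exact: cK2|exact: cK1].
have cQ w : {within `[0, T], continuous (fun t => Q t w)}.
  move=> t; apply: cvgD; last by apply: cvgB; [exact: cI2|exact: cI1].
  apply: cvg_mulmx; last exact: cK1.
  apply: cvg_mulmx; first exact: cK1.
  by apply: cvgB; [exact: cH1|exact: cH2].
have crhs (H I K : R -> Omega -> 'M[R]_d) w :
    {within `[0, T], continuous (fun t => H t w)} ->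
    {within `[0, T], continuous (fun t => I t w)} ->
    {within `[0, T], continuous (fun t => K t w)} ->
    {within `[0, T], continuous
      (fun t => riccati_rhs (G t w) (H t w) (I t w) (K t w))}.
  move=> cH cI cK t; apply: cvgB; last exact: cI.
  apply: cvgB; last by apply: cvg_mulmx; [exact: cK|exact: cG].
  apply: cvgB; last first.
    apply: cvg_mulmx; last exact: cK.
    by apply: cvg_trmx; exact: cG.
  by apply: cvg_mulmx; [apply: cvg_mulmx; [exact: cK|exact: cH]|exact: cK].
have cg1 w : {within `[0, T], continuous (g1 w)} by exact: crhs.
have cg2 w : {within `[0, T], continuous (g2 w)} by exact: crhs.
have driftE w r : 0 <= r <= T ->
    g1 w r - g2 w r = drift (A^~ w) (D^~ w) (Q^~ w) r.
  by move=> rT; apply: riccati_rhs_difference; [exact: sH2|exact: sK1|exact: sK2].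
have [N1 [noise1 eq1 end1]] := riccati_noise hW hFT T0 cg1 hE1.
have [N2 [noise2 eq2 end2]] := riccati_noise hW hFT T0 cg2 hE2.
pose N t w := N2 t w - N1 t w.
have [CG CG0 bG] := Linf_continuous_bounded hG.
have [CH CH0 bH] := Linf_continuous_bounded hH2.
have [C1 C10 b1] := Linf_continuous_bounded hK1.
have [C2 C20 b2] := Linf_continuous_bounded hK2.
pose C := CG + d%:R * CH * (C1 + C2) + (C1 + C2).
have C0 : 0 <= C by rewrite !addr_ge0// !mulr_ge0// addr_ge0.
have good : {ae P, forall w, nonneg_definite (D T w) /\ forall t, 0 <= t <= T ->
    [/\ (D t w)^T = D t w, nonneg_definite (Q t w), `|A t w| <= C &
        `|D t w| <= C]}.
  have bounds : {ae P, forall w, forall t, 0 <= t <= T ->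
      `|A t w| <= C /\ `|D t w| <= C}.
    apply: filterS2 (filterI bG bH) (filterI b1 b2) => w [GC HC] [K1C K2C] t tT.
    have Kb : `|Kbar t w| <= C1 + C2.
      rewrite /Kbar normrZ ger0_norm ?invr_ge0//.
      apply: (@le_trans _ _ (2^-1 * (C1 + C2))).
        by rewrite ler_wpM2l ?invr_ge0// (le_trans (ler_normD _ _))// lerD ?K1C ?K2C.
      by rewrite ler_piMl ?addr_ge0// invf_le1// ler1n.
    split.
      rewrite (le_trans (ler_normB _ _))// /C -[leLHS]addr0 lerD ?addr_ge0//.
      rewrite lerD ?GC// (le_trans (norm_mulmx _ _))//.
      by rewrite ler_pM ?mulr_ge0// ler_wpM2l// HC.
    rewrite (le_trans (ler_normB _ _))// /C -[leLHS]add0r lerD//.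
      by rewrite addr_ge0// !mulr_ge0// addr_ge0.
    by rewrite addrC lerD ?K1C ?K2C.
  have Qpos : {ae P, forall w, forall t, 0 <= t <= T -> nonneg_definite (Q t w)}.
    apply: filterS2 hH21 hI12 => w H21 I12 t tT x.
    rewrite -/(qform _ _) qformD addr_ge0//; last exact: I12.
    by apply: nonneg_definite_conj; [exact: sK1|exact: H21].
  have DT : {ae P, forall w, nonneg_definite (D T w)}.
    by apply: filterS3 end1 end2 hS12 => w; rewrite /D => -> ->.
  apply: filterS3 bounds Qpos DT => w bw Qw Dw; split=> // t tT.
  have [? ?] := bw t tT; split => //; last exact: Qw.
  by rewrite /D linearB /= (sK1 _ _ tT) (sK2 _ _ tT).
have mt (f : R -> Omega -> 'M[R]_d) (mf : forall i j, progressively_measurable T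
    (completed_filtration P W) (fun t w => f t w i j)) t : 0 <= t <= T ->
    forall i j, measurable_wrt (completed_filtration P W t) (fun w => f t w i j).
  by move=> tT i j; exact: (progressively_measurable_wrt (mf i j)).
have mD t i j : 0 <= t <= T ->
    measurable_wrt (completed_filtration P W t) (fun w => D t w i j).
  move=> tT; rewrite (_ : (fun w => _) = fun w => K2 t w i j - K1 t w i j).
    by apply: measurable_wrtB; exact: mt.
  by apply/funext => w; rewrite !mxE.
have mA t i j : 0 <= t <= T ->
    measurable_wrt (completed_filtration P W t) (fun w => A t w i j).
  move=> tT; rewrite (_ : (fun w => _) = fun w => G t w i j -
      \sum_k H2 t w i k * (2^-1 * (K1 t w k j + K2 t w k j))).
    apply: measurable_wrtB; first exact: mt.
    apply: measurable_wrt_sum => k; apply: measurable_wrtM; first exact: mt.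
    apply: measurable_wrtM; first exact: measurable_wrt_cst.
    by apply: measurable_wrtD; exact: mt.
  apply/funext => w; rewrite !mxE; congr (_ - _).
  by apply: eq_bigr => k _; rewrite !mxE.
have noise t i j : 0 <= t <= T -> P.-integrable setT (EFin \o (fun w => N t w i j)) /\
    forall (Y : Omega -> R) c, measurable_wrt (completed_filtration P W t) Y ->
    (forall w, `|Y w| <= c) -> \int[P]_w (Y w * N t w i j) = 0.
  move=> tT; have [i1 z1] := noise1 t i j tT; have [i2 z2] := noise2 t i j tT.
  have NE : (fun w => N t w i j) = fun w => N2 t w i j - N1 t w i j.
    by apply/funext => w; rewrite !mxE.
  split; first by rewrite NE; exact: integrable_sub.
  move=> Y c mY Yc.
  have mYT : measurable_fun setT Y.
    move=> _ B mB; rewrite setTI hFT.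
    by case/andP: tT => _ tT; apply: (completed_filtration_le tT); exact: mY.
  transitivity (\int[P]_w (Y w * N2 t w i j - Y w * N1 t w i j)).
    by apply: eq_Rintegral => w _; rewrite -mulrBr !mxE.
  rewrite RintegralB ?(z1 Y c) ?(z2 Y c) ?subrr//; exact: integrable_boundedM Yc _.
have eqD s t : 0 <= s -> s <= t -> t <= T -> {ae P, forall w,
    D s w - D t w - mx_integral (drift (A^~ w) (D^~ w) (Q^~ w)) s t =
    N t w - N s w}.
  move=> s0 st tT; apply: filterS2 (eq1 s t s0 st tT) (eq2 s t s0 st tT) => w e1 e2.
  have sub : `[s, t] `<=` `[0, T] by apply: subset_itv; rewrite bnd_simp.
  have -> : mx_integral (drift (A^~ w) (D^~ w) (Q^~ w)) s t =
      mx_integral (g1 w) s t - mx_integral (g2 w) s t.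
    rewrite -mx_integralB; [|exact: continuous_subspaceW (cg1 w)|
      exact: continuous_subspaceW (cg2 w)].
    apply/matrixP => i j; rewrite !mxE; apply: eq_Rintegral => r /set_mem /sub.
    by rewrite /= in_itv /= => rT; rewrite driftE.
  have -> : N t w - N s w = (N2 t w - N2 s w) - (N1 t w - N1 s w).
    by apply/matrixP => i j; rewrite !mxE; ring.
  by rewrite -e1 -e2; apply/matrixP => i j; rewrite !mxE; ring.
(* one null set for all integral vectors and rational times *)
pose test (c : 'cV[int]_d * (int * nat)) w :=
  let r : R := c.2.1%:~R / c.2.2.+1%:R in
  0 <= r <= T -> 0 <= qform (D r w) (map_mx (intmul 1) c.1).
have countable_test : {ae P, forall w, forall c, test c w}.
  have : {ae P, forall w, forall n : nat,
      if unpickle n is Some c then test c w else True}.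
    apply: ae_foralln => n; case: (unpickle n) => [c|]; last exact: aeW.
    rewrite /test /=; set r := _ / _.
    have [rT|rT] := boolP (0 <= r <= T); last by apply: aeW.
    have cont w : [/\ {within `[0, T], continuous (fun t => A t w)},
        {within `[0, T], continuous (fun t => D t w)} &
        {within `[0, T], continuous (fun t => Q t w)}] by [].
    have := @quadratic_form_ge0 R disp Omega P T W hFT d D A Q N C r
      (map_mx (intmul 1) c.1) rT C0 mA mD cont good noise eqD.
    by apply: filterS => w.
  apply: filterS => w Hw c; have := Hw (pickle c); rewrite pickleK; exact.
apply: filterS countable_test => w Hw.
apply: (qform_ge0_dense (cD w)) => z p q.
exact: (Hw (z, (p, q))).
Qed.
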